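(* Let $S$ be a countable (infinite) set with rates $c_{x,y}\in[0,+\infty)$, $x\ne y$ in $S$ (not necessarily symmetric), satisfying Assumption SEP. Given $f\in C(\{0,1\}^S)$ and $t\ge0$, the map $$S_tf(\sigma):=\mathbb E\big[f(\eta^\sigma_t[\mathcal K])\big]=\int d\mathbb P^\sigma(\eta_\cdot)\,f(\eta_t)$$ belongs to $C(\{0,1\}^S)$. In particular, the simple exclusion process with rates $c_{x,y}$ is a Feller process.
   Context: Setting. $S$ is a countable (infinite) set; $\mathcal E_S^o:=\{(x,y):x\ne y,\ x,y\in S\}$ (ordered pairs), $\mathcal E_S:=\{\{x,y\}:x\neq y,\ x,y\in S\}$ (unordered pairs). To each $(x,y)\in\mathcal E_S^o$ is associated $c_{x,y}\in[0,+\infty)$, not assumed symmetric; $c_{x,x}:=0$; $c^s_{x,y}:=c_{x,y}+c_{y,x}$. Path spaces. For a metric space $W$, $D_W=D(\mathbb R_+,W)$ is the space of càdlàg paths $\mathbb R_+=[0,+\infty)\to W$ with the Skorohod topology and its Borel $\sigma$-algebra. $\mathbb N=\{0,1,\dots\}$ is discrete; $\{0,1\}^S$ has the product topology. $D_{\mathbb N}^{\mathcal E_S^o}$ has the product topology, with generic element $\mathcal K=(\mathcal K_{x,y})_{(x,y)\in\mathcal E_S^o}$. $\mathbb P$ (with expectation $\mathbb E$) is the law on $D_{\mathbb N}^{\mathcal E_S^o}$ of a family $(N_{x,y}(\cdot))_{(x,y)\in\mathcal E_S^o}$ of independent Poisson processes, $N_{x,y}$ having intensity $c_{x,y}$ and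 $N_{x,y}(0)=0$. For $\{x,y\}\in\mathcal E_S$, $\mathcal K^s_{x,y}(t):=\mathcal K_{x,y}(t)+\mathcal K_{y,x}(t)$. Assumption SEP: there exists $t_0>0$ such that for $\mathbb P$-a.a. $\mathcal K$ the undirected graph $\mathcal G_{t_0}(\mathcal K)$ with vertex set $S$ and edge set $\{\{x,y\}\in\mathcal E_S:\mathcal K^s_{x,y}(t_0)>\mathcal K^s_{x,y}(0)\}$ has only connected components of finite cardinality. Such a $t_0$ is fixed. For $r\in\mathbb N$, $\mathcal G^r_{t_0}(\mathcal K)$ is the graph with vertex set $S$ and edge set $\{\{x,y\}\in\mathcal E_S:\mathcal K^s_{x,y}((r+1)t_0)>\mathcal K^s_{x,y}(rt_0)\}$, and $\Gamma_r$ is the set of $\mathcal K$ for which $\mathcal G^r_{t_0}(\mathcal K)$ has only finite connected components. $\Gamma_*$ is the set of $\mathcal K\in D_{\mathbb N}^{\mathcal E_S^o}$ such that: (i) $\mathcal K\in\cap_{r\in\mathbb N}\Gamma_r$; (ii) $\sum_{y\in S\setminus\{x\}}\mathcal K^s_{x,y}(t)<+\infty$ for all $x\in S$, $t\in\mathbb R_+$; (iii) for $(x,y)\ne(x',y')$ in $\mathcal E^o_S$ the sets of jump times of $\mathcal K_{x,y}$ and $\mathcal K_{x',y'}$ are disjoint, and all jumps equal $+1$; (iv) $\mathcal K_{x,y}(0)=0$ for all $(x,y)\in\mathcal E^o_S$. $\Gamma_*$ is Borel and $\mathbb P(\Gamma_* )=1$. Graphical construction. For $\mathcal K\in\Gamma_*$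 and $\sigma\in\{0,1\}^S$ define $(\eta^\sigma_t[\mathcal K])_{t\ge0}$ iteratively: $\eta^\sigma_0[\mathcal K]:=\sigma$. If defined up to time $rt_0$, $r\in\mathbb N$, for each (finite) connected component $C$ of $\mathcal G^r_{t_0}(\mathcal K)$ let $s_1<\dots<s_k$ be the times $s\in(rt_0,(r+1)t_0]$ at which $\mathcal K_{x,y}(s)=\mathcal K_{x,y}(s-)+1$ for some $x\neq y$ in $C$. On $C$, start from $\eta^\sigma_{rt_0}[\mathcal K]$ and, successively at $s=s_1,\dots,s_k$, move a particle from $x$ to $y$ ($x\ne y$ in $C$) if just before time $s$ site $x$ is occupied and $y$ is empty, and $\mathcal K_{x,y}(s)=\mathcal K_{x,y}(s-)+1$ (at most one such pair exists); between these times the configuration on $C$ is constant. This defines $\eta^\sigma_t[\mathcal K]$ for $t\in(rt_0,(r+1)t_0]$. The path $\eta^\sigma_\cdot[\mathcal K]$ belongs to $D_{\{0,1\}^S}$ and is measurable in $\mathcal K$. $\mathbb P^\sigma(A):=\mathbb P(\mathcal K\in\Gamma_*:\eta^\sigma_\cdot[\mathcal K]\in A)$ for Borel $A\subset D_{\{0,1\}^S}$; the family $(\mathbb P^\sigma)_\sigma$ is a Markov process, called the simple exclusion process (SEP) with rates $c_{x,y}$. $C(\{0,1\}^S)$ is the space of real continuous functions on $\{0,1\}^S$ with the uniform norm. Feller means that $S_t$ maps $C(\{0,1\}^S)$ into itself for all $t\geq 0$. *)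

(* Defs.v *)
From HB Require Import structures.
From Stdlib Require Import Relation_Operators.
From mathcomp Require Import all_boot all_order all_algebra.
From mathcomp Require Import finmap.
From mathcomp Require Import all_classical all_reals all_analysis.

Set Implicit Arguments.
Unset Strict Implicit.
Unset Printing Implicit Defensive.

Import Order.TTheory GRing.Theory Num.Theory.
Import numFieldNormedType.Exports.

Local Open Scope classical_set_scope.
Local Open Scope ring_scope.

Notation borel T := (g_sigma_algebraType (@open T)).

(* Paths R_+ -> W are encoded as functions on R that are constant on the
   negative half-line, so that two paths are equal iff they agree on R_+. *)
Record cadlag (R : realType) (W : uniformType) := Cadlag {
  path_val :> R -> W ;
  path_right_cts : forall t, 0 <= t -> path_val @ t^'+ --> path_val t ;
  path_left_lim : forall t, 0 < t -> exists l : W, path_val @ t^'- --> l ;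
  path_neg : forall t, t < 0 -> path_val t = path_val 0 }.

HB.instance Definition _ (R : realType) (W : uniformType) :=
  gen_eqMixin (cadlag R W).
HB.instance Definition _ (R : realType) (W : uniformType) :=
  gen_choiceMixin (cadlag R W).

Definition cst_path (R : realType) (W : uniformType) (a : W) : cadlag R W :=
  @Cadlag R W (fun=> a) (fun t _ => cvg_cst a)
    (fun t _ => ex_intro _ a (cvg_cst a)) (fun t _ => erefl).

HB.instance Definition _ (R : realType) (W : puniformType) :=
  isPointed.Build (cadlag R W) (cst_path R point).

Section skorohod.
Context (R : realType).

(* An increasing bijection of R_+ is automatically continuous and fixes 0. *)
Definition time_change (lam : R -> R) :=
  set_bij `[0, +oo[ `[0, +oo[ lam /\
  {in `[0, +oo[ &, {homo lam : s t / s < t}}.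

(* The sets [skorohod_nbhd w T e E] form a neighborhood base at w of the
   Skorohod (J1) topology on D(R_+, W): w_n -> w iff, for every T, there are
   time changes lam_n such that lam_n(s) -> s and the distance between w s and
   w_n (lam_n s) goes to 0, uniformly for s in [0, T]. For a metric space W,
   the entourages are those of its metric. *)
Definition skorohod_nbhd (W : uniformType) (w : cadlag R W) (T e : R)
    (E : set (W * W)) : set (cadlag R W) :=
  [set v | exists2 lam, time_change lam &
    forall s, 0 <= s <= T -> `|lam s - s| < e /\ E (w s, v (lam s))].

Definition skorohod_open (W : uniformType) (U : set (cadlag R W)) :=
  forall w, U w -> exists T e E,
    [/\ 0 < T, 0 < e, entourage E & skorohod_nbhd w T e E `<=` U].

Variable W : uniformType.

Let skorohod_openT : skorohod_open [set: cadlag R W].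
Proof.
by move=> w _; exists 1, 1, setT; split => //; exact: filterT.
Qed.

Let skorohod_openI : setI_closed (@skorohod_open W).
Proof.
move=> U V oU oV w [Uw Vw].
have [T1 [e1 [E1 [T10 e10 entE1 sU]]]] := oU _ Uw.
have [T2 [e2 [E2 [T20 e20 entE2 sV]]]] := oV _ Vw.
exists (Num.max T1 T2), (Num.min e1 e2), (E1 `&` E2); split.
- by rewrite lt_max T10.
- by rewrite lt_min e10.
- exact: filterI.
- move=> v [lam tlam H]; split.
    apply: sU; exists lam => // s /andP[s0 sT].
    have [|+ [? _]] := H s; first by rewrite s0 le_max sT.
    by rewrite lt_min => /andP[].
  apply: sV; exists lam => // s /andP[s0 sT].
  have [|+ [_ ?]] := H s; first by rewrite s0 le_max sT orbT.
  by rewrite lt_min => /andP[].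
Qed.

Let skorohod_open_bigU (I : Type) (f : I -> set (cadlag R W)) :
  (forall i, skorohod_open (f i)) -> skorohod_open (\bigcup_i f i).
Proof.
move=> of_ w [i _ fiw].
have [T [e [E [T0 e0 entE sfi]]]] := of_ i _ fiw.
by exists T, e, E; split => // v /sfi; exists i.
Qed.

HB.instance Definition _ := isOpenTopological.Build (cadlag R W)
  skorohod_openT skorohod_openI skorohod_open_bigU.

End skorohod.

Definition config (S : countType) : Type := {ptws S -> bool}.
HB.instance Definition _ (S : countType) :=
  Uniform.copy (config S) {ptws S -> bool}.
HB.instance Definition _ (S : countType) :=
  isPointed.Build (config S) (fun=> false).

Definition edge (S : countType) := {p : S * S | p.1 != p.2}.
Definition src (S : countType) (e : edge S) : S := (val e).1.
Definition dst (S : countType) (e : edge S) : S := (val e).2.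

Definition rev_edge (S : countType) (e : edge S) : edge S :=
  exist _ (dst e, src e) (etrans (congr1 negb (eq_sym _ _)) (valP e)).

Definition paths (R : realType) (S : countType) : Type :=
  {ptws edge S -> cadlag R nat}.
HB.instance Definition _ (R : realType) (S : countType) :=
  Topological.copy (paths R S) {ptws edge S -> cadlag R nat}.
HB.instance Definition _ (R : realType) (S : countType) :=
  isPointed.Build (paths R S) (fun=> cst_path R 0%N).

Section poisson.
Context d (T : measurableType d) (R : realType) (P : probability T R).

Definition independent_events (I : eqType) (E : I -> set T) :=
  forall s : seq I, uniq s ->
    P (\bigcap_(i in [set` s]) E i) = (\prod_(i <- s) P (E i))%E.

(* The second argument of the library's [poisson_prob] is a dummy; for rate 0
   it is the Dirac mass at 0. *)
Definition poisson_process (lam : R) (N : T -> cadlag R nat) :=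
  [/\ P [set w | N w 0 = 0%N] = 1%E,
      forall s t k, 0 <= s <= t ->
        P [set w | N w t = (N w s + k)%N] =
          poisson_prob (lam * (t - s)) 0 [set k] &
      forall (t : nat -> R) (k : nat -> nat),
        0 <= t 0%N -> {homo t : i j / (i <= j)%N >-> i <= j} ->
        independent_events
          (fun i => [set w | N w (t i.+1) = (N w (t i) + k i)%N])].

Definition independent_processes (I : eqType) (N : I -> T -> cadlag R nat) :=
  forall A : I -> set (borel (cadlag R nat)), (forall i, measurable (A i)) ->
    independent_events (fun i => N i @^-1` A i).

End poisson.

Section exclusion.
Context (R : realType) (S : countType).
Implicit Types K : paths R S.

(* The coordinate processes are independent Poisson processes: this
   characterizes the law P, as evaluations generate the Borel sigma-algebra. *)
Definition poisson_law (c : edge S -> R) (P : probability (borel (paths R S)) R) :=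
  (forall e, poisson_process P (c e) (fun K : paths R S => K e)) /\
  independent_processes P (fun e (K : paths R S) => K e).

Definition Ksym K (e : edge S) (t : R) : nat := (K e t + K (rev_edge e) t)%N.

Definition graph K (s t : R) : S -> S -> Prop := fun x y =>
  exists2 e : edge S, val e = (x, y) & (Ksym K e s < Ksym K e t)%N.

Definition component (adj : S -> S -> Prop) (x : S) : set S :=
  [set y | clos_refl_trans S adj x y].

Definition finite_components (adj : S -> S -> Prop) :=
  forall x, finite_set (component adj x).

Definition assumption_SEP (P : probability (borel (paths R S)) R) (t0 : R) :=
  {ae P, forall K, finite_components (graph K 0 t0)}.

Definition graph_r (t0 : R) K (r : nat) := graph K (r%:R * t0) (r.+1%:R * t0).

Definition Gamma_r (t0 : R) (r : nat) : set (paths R S) :=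
  [set K | finite_components (graph_r t0 K r)].

Definition left_lim (w : cadlag R nat) (s : R) : nat := lim (w @ s^'-).

Definition jump_times (w : cadlag R nat) : set R :=
  [set s | 0 < s /\ w s <> left_lim w s].

Definition up_jump (w : cadlag R nat) (s : R) := w s = (left_lim w s).+1.

Definition Gamma_star (t0 : R) : set (borel (paths R S)) :=
  [set K : paths R S |
    [/\ (\bigcap_r Gamma_r t0 r) K,
        forall (x : S) (t : R), 0 <= t ->
          (\esum_(e in [set e : edge S | src e = x])
             ((Ksym K e t)%:R : R)%:E < +oo)%E,
        (forall e e' : edge S, e <> e' ->
           jump_times (K e) `&` jump_times (K e') = set0) /\
        (forall e s, jump_times (K e) s -> up_jump (K e) s) &
        forall e, K e 0 = 0%N]].

(* Edges along which a particle jumps at time s within C. For K in Gamma_star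
   there is at most one, and [move] below transfers one particle. *)
Definition active K (C : set S) (s : R) (z : config S) : set (edge S) :=
  [set e | [/\ C (src e), C (dst e), up_jump (K e) s, z (src e) & ~~ z (dst e)]].

Definition move K (C : set S) (z : config S) (s : R) : config S := fun x =>
  if `[< exists2 e, active K C s z e & src e = x >] then false
  else if `[< exists2 e, active K C s z e & dst e = x >] then true
  else z x.

Definition update_times (t0 : R) K (r : nat) (C : set S) (t : R) : set R :=
  [set s | [/\ r%:R * t0 < s <= r.+1%:R * t0, s <= t &
    exists e : edge S, [/\ C (src e), C (dst e) & up_jump (K e) s]]].

(* Configuration at time t in (r t0, (r + 1) t0] from the one, z, at r t0.
   [update_times] is finite for K in Gamma_star and C a component. *)
Definition evolve (t0 : R) K (r : nat) (z : config S) (t : R) : config S := fun x =>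
  let C := component (graph_r t0 K r) x in
  foldl (move K C) z (sort <=%R (fset_set (update_times t0 K r C t))) x.

Fixpoint eta_grid (t0 : R) K (sigma : config S) (r : nat) : config S :=
  if r is r'.+1 then evolve t0 K r' (eta_grid t0 K sigma r') (r%:R * t0)
  else sigma.

Definition eta (t0 : R) K (sigma : config S) (t : R) : config S :=
  if t <= 0 then sigma else
  let r := (`|Num.ceil (t / t0)|%N).-1 in
  evolve t0 K r (eta_grid t0 K sigma r) t.

Definition SEP_law (P : probability (borel (paths R S)) R) (t0 : R)
    (sigma : config S) (A : set (borel (cadlag R (config S)))) : \bar R :=
  P [set K | Gamma_star t0 K /\
    exists2 w : cadlag R (config S), A w & eta t0 K sigma = w :> (R -> config S)].

Definition SEP_semigroup (P : probability (borel (paths R S)) R) (t0 : R)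
    (t : R) (f : config S -> R) (sigma : config S) : R :=
  \int[P]_(K in Gamma_star t0) f (eta t0 K sigma t).

Definition Feller
    (Q : config S -> set (borel (cadlag R (config S))) -> \bar R) :=
  forall (f : config S -> R) (t : R), continuous f -> 0 <= t ->
    continuous (fun sigma : config S =>
      fine (\int[Q sigma]_w (f ((w : cadlag R (config S)) t))%:E)).

End exclusion.

(* Main.v *)
Require Import Defs.
From Stdlib Require Import Relation_Operators.
From mathcomp Require Import all_boot all_order all_algebra.
From mathcomp Require Import finmap ring lra.
From mathcomp Require Import all_classical all_reals all_analysis.
From mathcomp Require Import measurable_realfun.

Set Implicit Arguments.
Unset Strict Implicit.
Unset Printing Implicit Defensive.

Import Order.TTheory GRing.Theory Num.Theory.
Import numFieldNormedType.Exports.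
Local Open Scope classical_set_scope.
Local Open Scope ring_scope.

(** The Feller property rests on a locality property of the graphical
    construction.  Fix a realization K in Gamma_star.  Up to time r * t0 the
    particles move inside the finite components of the r successive graphs, so
    the state of the site x at time t is a function of the initial states of
    finitely many sites: those of the component of x in the last graph, then
    those of the components of these sites in the graph before it, and so on
    ([eta_local]).  Hence sigma |-> eta_t^sigma[K] is continuous for the product
    topology ([continuous_eta]), and so is sigma |-> f (eta_t^sigma[K]) for f
    continuous.  As {0,1}^S is compact, f is bounded; as S is countable, the
    topology of {0,1}^S is described by sequences, and dominated convergence
    along these sequences gives the continuity of sigma |-> E[f (eta_t^sigma)]
    ([SEP_semigroup_continuous]).

    Most of the work is measurability: it makes the expectations meaningful and
    identifies them with integrals against the law of the path.  The main
    tool is that a right-continuous path with left limits in a discrete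
    space has at most one jump in each sufficiently short interval, uniformly on
    bounded time intervals ([step_path_one_jump], a compactness argument).

    - Evaluations at a fixed time are Borel for the Skorohod topology, because
      staying in a given uniformly clopen set on a neighbourhood of an interval
      is an open condition ([measurable_cadlag_eval]).

    - Conversely, a map into the paths of configurations is Borel as soon as its
      evaluations are measurable ([measurable_fun_skorohod]).  Record the path
      on finitely many sites at finitely many rational times, close to each
      other and such that between two of them the recorded path jumps at most
      once.  Two paths with the same record are matched by a time change moving
      each jump of one path to the corresponding jump of the other
      ([cells_time_change]).  These records are countably many, and
      every Skorohod open set is a union of the corresponding cells.

    - The conditions defining Gamma_star only involve countably many evaluations
      ([measurable_Gamma_star]): common jumps and jumps of height other than 1
      are detected on arbitrarily short intervals with rational end points.

    - On a finite component, the evolution driven by the jump times agrees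
      with the evolution driven by the increments over the cells of a time grid,
      once the grid is fine enough to have at most one jump in each cell
      ([evolution_gridP]).  So the configuration at time t is an eventually
      constant limit of functions of finitely many evaluations.

    Consequently the law of the process is the image of the restriction of P to
    Gamma_star under a measurable map ([SEP_lawE]), and the two expressions of
    the semigroup agree by the change of variables formula. *)

(** * Paths with finitely many jumps on bounded time intervals *)

(** The behaviour of a càdlàg path read through a locally constant observable.
    The set V of values carries no structure, so that the values of finitely many
    paths can be gathered into one sequence. *)
Definition step_path (R : realType) (V : Type) (u : R -> V) :=
  (forall t : R, 0 <= t -> exists2 d : R, 0 < d & forall s, t <= s < t + d -> u s = u t) /\
  (forall t : R, 0 < t -> exists2 d : R, 0 < d &
     exists v, forall s : R, t - d < s < t -> u s = v).

(** The jump may also occur at q itself, or be absent (then tau = q works). *)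
Definition one_jump (R : realType) (V : Type) (u : R -> V) (p q : R) :=
  exists tau, [/\ p < tau <= q,
    forall s, p <= s < tau -> u s = u p &
    forall s, tau <= s <= q -> u s = u q].

Lemma near_right_itv (R : realType) (t : R) (A : set R) :
  (\forall s \near t^'+, A s) -> exists2 d, 0 < d & forall s, t < s < t + d -> A s.
Proof.
case=> d /= d0 H; exists d => // s /andP[ts std]; apply: H => //=.
by rewrite distrC gtr0_norm ?subr_gt0// ltrBlDl.
Qed.

Lemma near_left_itv (R : realType) (t : R) (A : set R) :
  (\forall s \near t^'-, A s) -> exists2 d, 0 < d & forall s, t - d < s < t -> A s.
Proof.
case=> d /= d0 H; exists d => // s /andP[ts std]; apply: H => //=.
by rewrite gtr0_norm ?subr_gt0// ltrBlDr -ltrBlDl.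
Qed.

Lemma cadlag_step (R : realType) (W : uniformType) (V : Type) (g : W -> V)
    (w : cadlag R W) :
  (forall a, \forall b \near a, g b = g a) -> step_path (fun t => g (w t)).
Proof.
move=> gc; split=> t t0.
- have /near_right_itv[d d0 H] := @path_right_cts _ _ w _ t0 _ (gc (w t)).
  exists d => // s /andP[]; rewrite le_eqVlt => /orP[/eqP->//|ts std].
  by apply: H; rewrite ts.
- have [l wl] := @path_left_lim _ _ w _ t0.
  have /near_left_itv[d d0 H] := wl _ (gc l).
  by exists d => //; exists (g l).
Qed.

Lemma step_path_map (R : realType) (V : Type) (I : Type) (F : seq I)
    (u : I -> R -> V) :
  (forall i, step_path (u i)) -> step_path (fun s => [seq u i s | i <- F]).
Proof.
move=> su; elim: F => [|i F [IHr IHl]].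
  by split=> t t0; exists 1 => //; exists [::].
have [ur ul] := su i; split=> t t0.
- have [d d0 H] := ur _ t0; have [e e0 K] := IHr _ t0.
  exists (Num.min d e); first by rewrite lt_min d0.
  move=> s /andP[ts]; rewrite -ltrBlDl lt_min !ltrBlDl => /andP[sd se] /=.
  by rewrite H ?ts// K ?ts.
- have [d d0 [v H]] := ul _ t0; have [e e0 [z K]] := IHl _ t0.
  exists (Num.min d e); first by rewrite lt_min d0.
  exists (v :: z) => s /andP[]; rewrite ltrBlDr -ltrBlDl lt_min.
  rewrite !ltrBlDl => /andP[sd se] st /=.
  by rewrite H ?K ?st ?andbT// ltrBlDr.
Qed.

(** Around each time t the path is constant just before t and just after t, so a
    short interval near t sees no jump except possibly t; compactness of [0, T]
    makes the length uniform. *)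
Lemma step_path_one_jump (R : realType) (V : Type) (u : R -> V) (T : R) :
  step_path u -> exists2 d, 0 < d &
    forall p q, 0 <= p <= T -> p < q < p + d -> one_jump u p q.
Proof.
move=> [ur ul].
pose P (d p : R) := 0 <= p -> forall q, p < q < p + d -> one_jump u p q.
have loc t : 0 <= t -> exists2 d, 0 < d &
    forall p q, 0 <= p -> t - d < p -> p < q -> q < t + d -> one_jump u p q.
  move=> t0; have [d d0 H] := ur _ t0.
  have [e [e0 [v K]]] : exists e, 0 < e /\
      exists v, forall s, 0 <= s -> t - e < s < t -> u s = v.
    move: t0; rewrite le_eqVlt => /orP[/eqP<-|/ul[e e0 [v K]]].
      by exists 1; split => //; exists (u 0) => s s0 sl; exfalso; lra.
    by exists e; split => //; exists v => s _; exact: K.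
  exists (Num.min d e); first by rewrite lt_min d0.
  move=> p q p0; rewrite ltrBlDr -ltrBlDl -ltrBlDl !lt_min.
  move=> /andP[pd pe] pq /andP[qd qe].
  have [tp|pt] := leP t p.
    exists q; split; rewrite ?pq//=.
    - by move=> s sp; rewrite (H s) ?(H p)//; lra.
    - by move=> s sp; congr (u _); apply/eqP; rewrite eq_le; lra.
  have [tq|qt] := leP t q.
    exists t; split; rewrite ?pt//=.
    - by move=> s sp; rewrite (K s) ?(K p)//; lra.
    - by move=> s sp; rewrite (H s) ?(H q)//; lra.
  exists q; split; rewrite ?pq//=.
  - by move=> s sp; rewrite (K s) ?(K p)//; lra.
  - by move=> s sp; congr (u _); apply/eqP; rewrite eq_le; lra.
have /compact_near_coveringP/(_ R 0^'+ P _) := @segment_compact R 0 T.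
case=> [x /=|d /= d0 H].
  rewrite in_itv /= => /andP[x0 xT].
  have [d d0 H] := loc _ x0.
  near=> y e => /= y0 q /andP[yq qe].
  have yx : `|x - y| < d / 2 by near: y; exists (d/2) => //=; lra.
  have ed : e < d / 2.
    by near: e; apply: nbhs_right_lt; lra.
  by move: yx; rewrite ltr_norml => /andP[yx1 yx2]; apply: H => //; lra.
exists (d / 2); first by lra.
move=> p q pT pq; apply: (H (d/2)) => //=; [|by lra|by case/andP: pT].
  by rewrite sub0r normrN gtr0_norm; lra.
Unshelve. all: by end_near. Qed.

(** * Configurations: the product topology and its uniformity *)

(** The uniformity of {0,1}^S is generated by the equalities of coordinates,
    since equality is an entourage of the discrete space {0,1}. *)
Lemma config_entourage_cylinder (S : countType) (E : set (config S * config S)) :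
  entourage E -> exists F : seq S,
    forall z z' : config S, (forall x, x \in F -> z x = z' x) -> E (z, z').
Proof.
move=> [B [X XT <-] BE].
exists ([seq (sval q).1 | q <- enum_fset X] : seq {classic S}) => z z' zz'.
apply: BE => p pX.
have zp : z (sval p).1 = z' (sval p).1 by apply: zz'; exact: (@map_f _ S).
case: p zp {pX} => -[x D] /= /asboolP [V /= entV VD] zx.
by apply: VD; change (V (z x, z' x)); rewrite zx; exact: entourage_refl.
Qed.

Lemma config_entourage_coord (S : countType) (x : S) :
  entourage [set p : config S * config S | p.1 x = p.2 x].
Proof.
pose D := [set p : config S * config S | p.1 x = p.2 x].
have entD : `[< @entourage (initial_topology (@proj _ (fun _ : S => bool) x)) D >].
  apply/asboolP; exists [set p | p.1 = p.2]; last by [].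
  by rewrite uniform_discrete => _ [b _ <-].
pose I := {p : {classic S} * set ({ptws S -> bool} * {ptws S -> bool}) |
   `[< @entourage (initial_topology (@proj _ (fun _ : S => bool) p.1)) p.2 >]}.
pose e : I := exist _ (x : {classic S}, D) entD.
exists D; last by [].
exists [fset e]%fset; first by move=> p _; rewrite in_setT.
rewrite eqEsubset; split => [p /(_ e)|p Dp q].
  by apply; rewrite /= inE.
by rewrite /= inE => /eqP ->.
Qed.

Lemma nbhs_config_cylinder (S : countType) (z : config S) (A : set (config S)) :
  nbhs z A -> exists F : seq S,
    forall z' : config S, (forall x, x \in F -> z x = z' x) -> A z'.
Proof.
move=> /nbhsP[E /config_entourage_cylinder[F HF] EA]; exists F => z' zz'.
by apply: EA; apply/mem_set; exact: HF.
Qed.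

Lemma nbhs_config_coord (S : countType) (z : config S) (x : S) :
  \forall z' \near z, z' x = z x.
Proof.
apply/nbhsP; exists [set p : config S * config S | p.1 x = p.2 x].
  exact: config_entourage_coord.
by move=> z' /set_mem /= ->.
Qed.

Lemma cvg_config (S : countType) (T : Type) (G : set_system T)
    (w : T -> config S) (z : config S) : Filter G ->
  (forall x, \forall s \near G, w s x = z x) -> w @ G --> z.
Proof.
move=> FG H A /nbhs_config_cylinder[F HF].
have : \forall s \near G, forall x, x \in F -> z x = w s x.
  elim: F {HF} => [|x F IH]; first by apply: filterE.
  apply: filterS2 (H x) IH => s xs HF y; rewrite inE => /orP[/eqP->|]//.
  exact: HF.
by apply: filterS => s /HF.
Qed.

(** * Events built from countable quantifiers *)

(** The lemmas [event_*] mirror the logical connectives, so that a set given by a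
    formula with countable quantifiers is proved measurable by following the
    formula. *)
Lemma event_exists d (T : measurableType d) (I : countType)
    (P : I -> T -> Prop) :
  (forall i, measurable [set w | P i w]) -> measurable [set w | exists i, P i w].
Proof.
move=> mP; rewrite (_ : [set _ | _] = \bigcup_n
    (if choice.unpickle n is Some i then [set w | P i w] else set0)).
  by apply: bigcupT_measurable => n; case: choice.unpickle.
rewrite eqEsubset; split=> [w [i Pi]|w [n _]].
  by exists (choice.pickle i) => //; rewrite choice.pickleK.
by case: choice.unpickle => // i Pi; exists i.
Qed.

Lemma event_not d (T : measurableType d) (P : T -> Prop) :
  measurable [set w | P w] -> measurable [set w | ~ P w].
Proof. exact: measurableC. Qed.

Lemma event_forall d (T : measurableType d) (I : countType)
    (P : I -> T -> Prop) :
  (forall i, measurable [set w | P i w]) -> measurable [set w | forall i, P i w].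
Proof.
move=> mP; rewrite (_ : [set _ | _] = ~` [set w | exists i, ~ P i w]).
  by apply/measurableC/event_exists => i; exact: event_not.
rewrite eqEsubset; split=> w /=; first by move=> Pw [i]; apply; exact: Pw.
by move=> nP i; apply: contrapT => nPi; apply: nP; exists i.
Qed.

Lemma event_and d (T : measurableType d) (P Q : T -> Prop) :
  measurable [set w | P w] -> measurable [set w | Q w] ->
  measurable [set w | P w /\ Q w].
Proof. exact: measurableI. Qed.

Lemma event_or d (T : measurableType d) (P Q : T -> Prop) :
  measurable [set w | P w] -> measurable [set w | Q w] ->
  measurable [set w | P w \/ Q w].
Proof. exact: measurableU. Qed.

Lemma event_prop d (T : measurableType d) (P : Prop) :
  measurable [set _ : T | P].
Proof.
have [p|np] := pselect P.
  by rewrite (_ : [set _ | _] = setT)//; rewrite eqEsubset; split.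
by rewrite (_ : [set _ | _] = set0)//; rewrite eqEsubset; split.
Qed.

(** The premise does not depend on the outcome; it may be used to prove that
    the conclusion is an event. *)
Lemma event_imp d (T : measurableType d) (P : Prop) (Q : T -> Prop) :
  (P -> measurable [set w | Q w]) -> measurable [set w | P -> Q w].
Proof.
move=> mQ; have [p|np] := pselect P.
  rewrite (_ : [set _ | _] = [set w | Q w]); first exact: mQ.
  by rewrite eqEsubset; split=> w /=; [exact|].
by rewrite (_ : [set _ | _] = setT)// eqEsubset; split=> w //= _ /np.
Qed.

Lemma event_comp_pred d (T : measurableType d) (V : countType)
    (u : T -> V) (A : V -> Prop) :
  (forall v, measurable [set w | u w = v]) -> measurable [set w | A (u w)].
Proof.
move=> mu; rewrite (_ : [set _ | _] = [set w | exists v, u w = v /\ A v]).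
  by apply: event_exists => v; apply: event_and => //; exact: event_prop.
rewrite eqEsubset; split=> w /=; first by exists (u w).
by move=> [v [<-]].
Qed.

Lemma event_eq_map d (T : measurableType d) (V : countType) (I : Type)
    (F : seq I) (u : I -> T -> V) (l : seq V) :
  (forall i v, measurable [set w | u i w = v]) ->
  measurable [set w | [seq u i w | i <- F] = l].
Proof.
move=> mu; elim: F l => [|i F IH] [|v l] /=; [exact: event_prop|exact: event_prop| |].
  by rewrite (_ : [set _ | _] = set0)// eqEsubset; split.
rewrite (_ : [set _ | _] = [set w | u i w = v /\ [seq u i w | i <- F] = l]).
  exact: event_and.
by rewrite eqEsubset; split=> w /= [-> ->].
Qed.

(** * Evaluations are Borel for the Skorohod topology *)

(** The interval is allowed to be empty: if b < a then the condition is void for h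
    small, as happens in [measurable_cadlag_eval]. *)
Definition near_itv_in (R : realType) (W : uniformType) (A : set W) (a b : R) :
    set (cadlag R W) :=
  [set w | exists2 h, 0 < h & forall s, 0 <= s -> a - h <= s <= b + h -> A (w s)].

(** A time change displacing times by less than h / 2 loses at most h / 2 at each
    end of the interval. *)
Lemma open_near_itv_in (R : realType) (W : uniformType) (A : set W) (a b : R) :
  0 <= a -> entourage [set p : W * W | A p.1 -> A p.2] ->
  open (near_itv_in A a b).
Proof.
move=> a0 entA; change (skorohod_open (near_itv_in A a b)) => w [h h0 H].
exists (`|b| + h), (h / 2), [set p : W * W | A p.1 -> A p.2]; split => //.
- by rewrite ltr_wpDl.
- by rewrite divr_gt0.
move=> v [lam [[_ _ lam_surj] lam_lt] Hlam]; exists (h / 2); first by rewrite divr_gt0.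
move=> s' s'0 s'ab.
have [|s /=] := lam_surj s'; first by rewrite /= in_itv /= s'0.
rewrite in_itv /= andbT => s0 ls; rewrite -ls.
have b_le := ler_norm b; have b_ge0 := normr_ge0 b.
have sT : s <= `|b| + h.
  (* a time beyond the horizon is sent beyond the time b + h / 2 *)
  rewrite leNgt; apply/negP => Ts.
  have T0 : 0 <= `|b| + h by lra.
  have : lam (`|b| + h) < lam s.
    by apply: lam_lt; rewrite // in_itv /= andbT.
  have [|+ _] := Hlam (`|b| + h); first by rewrite T0 lexx.
  by rewrite ltr_norml ls; lra.
have [|+ +] := Hlam s; first by rewrite s0.
by rewrite ltr_norml ls => ? /=; apply; apply: H => //; lra.
Qed.

Lemma event_iff d (T : measurableType d) (Q P : T -> Prop) :
  (forall w, P w <-> Q w) -> measurable [set w | Q w] -> measurable [set w | P w].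
Proof.
move=> PQ; rewrite (_ : [set w | P w] = [set w | Q w])//.
by rewrite eqEsubset; split=> w /PQ.
Qed.

Lemma natSinv_lt (R : realType) (e : R) : 0 < e -> exists n : nat, n.+1%:R^-1 < e.
Proof.
move=> e0; have [n _ Hn] := near_infty_natSinv_lt (PosNum e0).
by exists n; exact: (Hn n (leqnn n)).
Qed.

(** Membership in A at the time t itself is not an open condition, since t may be
    a jump time.  By right continuity it amounts to staying in A on some
    [t + 1/(m+1), t + 1/(n+1)] with n fixed and m arbitrary. *)
Lemma measurable_cadlag_eval (R : realType) (W : puniformType) (A : set W) (t : R) :
  entourage [set p : W * W | A p.1 -> A p.2] -> 0 <= t ->
  measurable ([set w | A (w t)] : set (borel (cadlag R W))).
Proof.
move=> entA t0.
apply: (@event_iff _ (borel (cadlag R W)) (fun w => exists n : nat,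
    forall m : nat, near_itv_in A (t + m.+1%:R^-1) (t + n.+1%:R^-1) w)
    (fun w => A ((w : cadlag R W) t))).
  move=> w; split.
  - move=> Awt.
    have /near_right_itv[d d0 H] : \forall s \near t^'+, A (w s).
      apply: (@path_right_cts _ _ w _ t0 [set a | A a]).
      apply/nbhsP; exists [set p : W * W | A p.1 -> A p.2] => // b /set_mem.
      exact.
    have H' s : t <= s < t + d -> A (w s).
      by move=> /andP[]; rewrite le_eqVlt => /orP[/eqP<-//|ts ?]; apply: H; rewrite ts.
    have d20 : 0 < d / 2 by lra.
    have [n nd] := natSinv_lt d20.
    exists n => m; exists (Num.min (d / 2) (m.+1%:R^-1)).
      by rewrite lt_min d20 invr_gt0 ltr0n.
    move=> s s0 /andP[s1 s2]; apply: H'; apply/andP; split.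
      apply: le_trans s1; rewrite -addrA lerDl subr_ge0. 
      by rewrite ge_min lexx orbT.
    have : Num.min (d / 2) m.+1%:R^-1 <= d / 2 by rewrite ge_min lexx.
    by move: s2 nd; set y := (n.+1%:R^-1); set x := Num.min _ _; lra.
  - move=> [n H].
    have Hr s : t < s < t + n.+1%:R^-1 -> A (w s).
      move=> /andP[ts st].
      have [m mst] : exists m : nat, m.+1%:R^-1 < s - t.
        by apply: natSinv_lt; rewrite subr_gt0.
      have [h h0] := H m; move: mst; set y := (n.+1%:R^-1) in st *.
      by set z := (m.+1%:R^-1) => mst; apply; lra.
    have : \forall b \near w t, A b -> A (w t).
      apply/nbhsP; exists [set p : W * W | A p.2 -> A p.1].
        exact: (entourage_inv entA).
      by move=> b /set_mem.
    move=> /(@path_right_cts _ _ w _ t0 _)/near_right_itv[d d0 K].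
    have n0 : 0 < n.+1%:R^-1 :> R by rewrite invr_gt0 ltr0n.
    move: Hr n0; set y := (n.+1%:R^-1) => Hr n0.
    pose e := Num.min d y.
    have e0 : 0 < e by rewrite lt_min d0 n0.
    have [ed en] : e <= d /\ e <= y by rewrite !ge_min !lexx orbT.
    by apply: (K (t + e / 2)); [lra|apply: Hr; lra].
apply: event_exists => n; apply: event_forall => m.
apply: sub_sigma_algebra; apply: open_near_itv_in => //.
by rewrite addr_ge0// invr_ge0 ler0n.
Qed.

Lemma measurable_fun_generated d (T : measurableType d) (U : pointedType)
    (G : set (set U)) (f : T -> g_sigma_algebraType G) :
  (forall A : set U, G A -> measurable (f @^-1` A)) ->
  measurable_fun [set: T] f.
Proof.
move=> H; apply: (@measurability _ _ _ _ setT f G) => // _ [A oA <-].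
by rewrite setTI; exact: H.
Qed.

Lemma measurable_paths_eval (R : realType) (S : countType) (e : edge S) (t : R)
    (k : nat) : 0 <= t ->
  measurable ([set K | K e t = k] : set (borel (paths R S))).
Proof.
move=> t0.
have me : measurable_fun [set: borel (paths R S)]
    (fun K : borel (paths R S) => (K : paths R S) e : borel (cadlag R nat)).
  apply: (@measurable_fun_generated _ (borel (paths R S)) (cadlag R nat)) => A oA.
  apply: sub_sigma_algebra.
  apply: (@open_comp _ _ (fun K : paths R S => K e)) => // K _.
  exact: (@proj_continuous _ (fun _ : edge S => cadlag R nat) e K).
have := me measurableT [set w : borel (cadlag R nat) | (w : cadlag R nat) t = k].
rewrite setTI; apply; apply: (@measurable_cadlag_eval R nat [set n | n = k]) => //.
by rewrite uniform_discrete => _ [n _ <-].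
Qed.

Lemma measurable_config_path_eval (R : realType) (S : countType) (x : S) (t : R)
    (b : bool) : 0 <= t ->
  measurable ([set w | (w : cadlag R (config S)) t x = b] :
    set (borel (cadlag R (config S)))).
Proof.
move=> t0; apply: (@measurable_cadlag_eval R (config S) [set z | z x = b]) => //.
by apply: filterS (config_entourage_coord x) => p /= ->.
Qed.

(** * Single jumps seen from rational times *)

(** Compared with [one_jump], the jump is required to avoid q: then both end points
    can be kept fixed by a time change moving the jump. *)
Definition inner_jump (R : realType) (V : Type) (u : R -> V) (p q : R) :=
  exists tau, [/\ p < tau < q,
    forall s, p <= s < tau -> u s = u p &
    forall s, tau <= s <= q -> u s = u q].

Definition rat_inner_jump (R : realType) (V : Type) (u : R -> V) (p q : rat) :=
  (exists q' : rat, p < q' < q /\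
     forall s : rat, q' <= s <= q -> u (ratr s) = u (ratr q)) /\
  (forall s s' : rat, p <= s -> s < s' -> s' <= q ->
     u (ratr s) = u (ratr p) \/ u (ratr s') = u (ratr q)).

Lemma rat_between (R : realType) (a b : R) : a < b -> exists q : rat, a < ratr q < b.
Proof.
move=> /rat_in_itvoo[q]; rewrite in_itv /= => ?; by exists q.
Qed.

Lemma right_rat (R : realType) (V : Type) (u : R -> V) (a b : R) : step_path u ->
  0 <= a -> a < b -> exists s : rat, a < ratr s < b /\ u (ratr s) = u a.
Proof.
move=> [ur _] a0 ab; have [d d0 H] := ur _ a0.
have abd : a < Num.min b (a + d) by rewrite lt_min ab ltrDl.
have [s] := rat_between abd; rewrite lt_min => /and3P[as_ sb sd].
by exists s; rewrite as_ sb H// sd ltW.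
Qed.

(** The rational condition says that once the path has left its initial value it
    has its final value; the jump time is then the infimum of the times at which
    the initial value has been left. *)
Lemma inner_jump_ratP (R : realType) (V : Type) (u : R -> V) (p q : rat) :
  step_path u -> 0 <= p -> p < q ->
  inner_jump u (ratr p) (ratr q) <-> rat_inner_jump u p q.
Proof.
move=> su p0 pq; split.
  move=> [tau [/andP[ptau tauq] H K]]; split.
    have [q' /andP[tq' q'q]] := rat_between tauq.
    exists q'; rewrite -!(ltr_rat R) q'q (lt_trans ptau)//; split=> // s.
    rewrite -!(ler_rat R) => /andP[q's sq]; apply: K.
    by rewrite sq (le_trans (ltW tq')).
  move=> s s'; rewrite -(ltr_rat R) -!(ler_rat R) => ps ss' s'q.
  have [tau_s|s_tau] := leP tau (ratr s).
    by right; apply: K; rewrite s'q (le_trans tau_s) ?ltW.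
  by left; apply: H; rewrite ps.
move=> [[q' [/andP[pq' q'q] Kq]] alt].
have rp0 : 0 <= ratr p :> R by rewrite ler0q.
move: pq' q'q; rewrite -!(ltr_rat R) => pq' q'q.
(* the two conditions extend to real times by right continuity *)
have altR s s' : ratr p <= s -> s < s' -> s' <= ratr q ->
    u s = u (ratr p) \/ u s' = u (ratr q).
  move=> ps ss' s'q.
  have [r [/andP[sr rs'] ur]] := right_rat su (le_trans rp0 ps) ss'.
  rewrite -ur; move: s'q; rewrite le_eqVlt => /orP[/eqP->|s'q]; first by right.
  have s'0 : 0 <= s' by rewrite (le_trans rp0)// (le_trans ps)// ltW.
  have [r' [/andP[s'r' r'q] <-]] := right_rat su s'0 s'q.
  by apply: alt; rewrite -?(ltr_rat R) -?(ler_rat R); lra.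
pose A := [set s | ratr p <= s <= ratr q /\ u s <> u (ratr p)].
have [A0|A0] := pselect (A !=set0); last first.
  exists (ratr q'); rewrite pq' q'q; split=> // s sq; last first.
    apply: contrapT => ne; apply: A0; have [//|Aq] := pselect (u s = u (ratr p)).
      move=> e; exists (ratr q); split; first by rewrite lexx andbT; lra.
      by rewrite -e => e'; apply: ne.
    by exists s; split => //; lra.
  by apply: contrapT => ne; apply: A0; exists s; split => //; lra.
have Alb : has_lbound A by exists (ratr p) => s [/andP[]].
have hiA : has_inf A by [].
pose tau := inf A.
have tau_le s : A s -> tau <= s by move=> As; exact: ge_inf.
have before s : ratr p <= s -> s < tau -> u s = u (ratr p).
  move=> ps st; apply: contrapT => ne.
  have [b Ab] := A0; have := tau_le _ Ab; case: Ab => /andP[pb bq] _ tb.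
  have /tau_le : A s by split => //; lra.
  lra.
have after s : tau < s -> s <= ratr q -> u s = u (ratr q).
  move=> ts sq; have [b Ab bs] : exists2 b, A b & b < s by exact: inf_lt.
  by case: Ab => /andP[pb bq] ne; have [] := altR _ _ pb bs sq.
have ptau : ratr p <= tau.
  by apply: lb_le_inf => // s [/andP[]].
have tauq : tau < ratr q.
  have [b [/andP[pb bq] nb]] := A0.
  have tb : tau <= b by apply: tau_le; split => //; lra.
  rewrite lt_neqAle (le_trans tb bq) andbT; apply/eqP => tq.
  have eq' : u (ratr q') = u (ratr p) by apply: before; lra.
  apply: nb; rewrite -eq' (Kq q') ?lexx /= -?(ler_rat R); last lra.
  by congr (u _); apply/eqP; rewrite eq_le; lra.
have tau0 := le_trans rp0 ptau.
have at_tau : u tau = u (ratr q).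
  have [r [/andP[tr rq] <-]] := right_rat su tau0 tauq.
  by apply: after => //; lra.
exists tau; split.
- rewrite tauq andbT lt_neqAle ptau andbT; apply/eqP => ptau'.
  have [b [/andP[pb bq] nb]] := A0; apply: nb.
  rewrite ptau' at_tau; move: pb; rewrite ptau' le_eqVlt => /orP[/eqP<-//|tb].
  exact: after.
- by move=> s /andP[]; exact: before.
- move=> s /andP[]; rewrite le_eqVlt => /orP[/eqP<-//|]; exact: after.
Qed.

(** * Time changes aligning the jumps of two paths *)

(** The piecewise linear map of [p, q] onto itself that sends a to b, extended by
    the identity. *)
Definition bump (R : realType) (p a b q s : R) : R :=
  if s <= p then s
  else if s <= a then p + (s - p) * ((b - p) / (a - p))
  else if s <= q then q - (q - s) * ((q - b) / (q - a))
  else s.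

Section Bump.
Context (R : realType) (p q : R).
Implicit Types a b s : R.

Lemma bump_out a b s : p < a -> a < q -> s <= p \/ q < s -> bump p a b q s = s.
Proof.
move=> pa aq; rewrite /bump; have [//|ps [|qs]] := leP s p; first by lra.
have [sa|as_] := leP s a; first by lra.
by have [|] := leP s q; lra.
Qed.

Lemma bump_left a b s : p < a -> p < b -> p < s -> s <= a ->
  bump p a b q s = p + (s - p) * ((b - p) / (a - p)) /\
  (p < bump p a b q s <= b) /\ (s < a -> bump p a b q s < b).
Proof.
move=> pa pb ps sa; rewrite /bump leNgt ps sa /=; split=> //.
have k0 : 0 < (b - p) / (a - p) by rewrite divr_gt0// subr_gt0.
have kE : (a - p) * ((b - p) / (a - p)) = b - p by rewrite mulrC divfK//; lra.
set k := _ / _ in k0 kE *.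
by split=> [|sa']; nra.
Qed.

Lemma bump_right a b s : p < a -> a < q -> b < q -> a < s -> s <= q ->
  bump p a b q s = q - (q - s) * ((q - b) / (q - a)) /\ b < bump p a b q s <= q.
Proof.
move=> pa aq bq as_ sq; rewrite /bump !leNgt (lt_trans pa)// as_ -leNgt sq /=.
split=> //.
have k0 : 0 < (q - b) / (q - a) by rewrite divr_gt0// subr_gt0.
have kE : (q - a) * ((q - b) / (q - a)) = q - b by rewrite mulrC divfK//; lra.
set k := _ / _ in k0 kE *.
by nra.
Qed.

Lemma bumpK a b : p < a < q -> p < b < q -> cancel (bump p a b q) (bump p b a q).
Proof.
move=> /andP[pa aq] /andP[pb bq] s.
have [sp|ps] := leP s p; first by rewrite !bump_out//; left.
have [qs|sq] := ltP q s; first by rewrite !bump_out//; right.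
have [sa|as_] := leP s a.
  have [e [/andP[h1 h2] _]] := bump_left pa pb ps sa.
  have [-> _] := bump_left pb pa h1 h2; rewrite e.
  by field; rewrite !subr_eq0 !gt_eqF.
have [e /andP[h1 h2]] := bump_right pa aq bq as_ sq.
have [-> _] := bump_right pb bq aq h1 h2; rewrite e.
by field; rewrite !subr_eq0 !gt_eqF.
Qed.

Lemma bump_homo a b : p < a < q -> p < b < q ->
  {homo bump p a b q : s t / s < t}.
Proof.
move=> /andP[pa aq] /andP[pb bq] s t st.
have k0 : 0 < (b - p) / (a - p) by rewrite divr_gt0// subr_gt0.
have l0 : 0 < (q - b) / (q - a) by rewrite divr_gt0// subr_gt0.
have loc r : [\/ r <= p /\ bump p a b q r = r, q < r /\ bump p a b q r = r,
    [/\ p < r, r <= a, bump p a b q r = p + (r - p) * ((b - p) / (a - p)),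
        p < bump p a b q r & bump p a b q r <= b] |
    [/\ a < r, r <= q, bump p a b q r = q - (q - r) * ((q - b) / (q - a)),
        b < bump p a b q r & bump p a b q r <= q]].
  have [rp|pr] := leP r p; first by apply: Or41; rewrite bump_out//; left.
  have [qr|rq] := ltP q r; first by apply: Or42; rewrite bump_out//; right.
  have [ra|ar] := leP r a.
    by apply: Or43; have [? [/andP[]]] := bump_left pa pb pr ra.
  by apply: Or44; have [? /andP[]] := bump_right pa aq bq ar rq.
move: k0 l0 (loc s) (loc t); set k := _ / _; set l := _ / _ => k0 l0.
case=> [[? ->]|[? ->]|[? ? e ? ?]|[? ? e ? ?]] [[? e']|[? e']|[? ? e' ? ?]|[? ? e' ? ?]];
  by nra.
Qed.
End Bump.

Fixpoint mesh (R : realType) (e p : R) (l : seq R) : Prop :=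
  if l is q :: l' then p < q < p + e /\ mesh e q l' else True.

Fixpoint cells (R : realType) (V : Type) (u : R -> V) (p : R) (l : seq (R * V)) : Prop :=
  if l is (q, z) :: l' then [/\ inner_jump u p q, u q = z & cells u q l']
  else True.

Lemma mesh_last (R : realType) (e p : R) (l : seq R) : mesh e p l -> p <= last p l.
Proof.
elim: l p => [|q l IH] p //= [/andP[pq _] /IH]; apply: le_trans; exact: ltW.
Qed.

(** Time changes of consecutive intervals are composed: each of them is the identity
    outside of its interval, so they do not interfere.  The displacement is
    bounded by the mesh since each interval is mapped onto itself. *)
Lemma cells_time_change (R : realType) (V : Type) (u v : R -> V) (e p : R)
    (l : seq (R * V)) :
  0 < e -> mesh e p (map fst l) -> u p = v p -> cells u p l -> cells v p l ->
  exists lam mal : R -> R,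
    [/\ cancel lam mal, cancel mal lam, {homo lam : s t / s < t},
        forall s, s <= p -> lam s = s &
        forall s, `|lam s - s| < e /\
          (p <= s <= last p (map fst l) -> u s = v (lam s))].
Proof.
move=> e0; elim: l p => [|[q z] l IH] p /=.
  move=> _ upvp _ _; exists id, id; split=> // s; rewrite subrr normr0; split=> //.
  by move=> /le_anti <-.
move=> [/andP[pq qpe] ml] upvp [uj uq ul] [vj vq vl].
have [lam [mal [K1 K2 lam_lt lam_id lamP]]] := IH _ ml (etrans uq (esym vq)) ul vl.
have [a [/[dup] paq /andP[pa aq] ua1 ua2]] := uj.
have [b [/[dup] pbq /andP[pb bq] vb1 vb2]] := vj.
have qlast := mesh_last ml.
have bump_q s : s <= q -> bump p a b q s <= q.
  move=> sq; have [sp|ps] := leP s p; first by rewrite bump_out//; left.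
  have [sa|as_] := leP s a; last by have [_ /andP[]] := bump_right pa aq bq as_ sq.
  by have [_ [/andP[_ sb] _]] := bump_left q pa pb ps sa; rewrite (le_trans sb)// ltW.
exists (lam \o bump p a b q), (bump p b a q \o mal); split.
- by move=> s /=; rewrite K1 bumpK.
- by move=> s /=; rewrite bumpK// K2.
- by move=> s t st /=; apply/lam_lt/bump_homo.
- by move=> s sp /=; rewrite bump_out ?lam_id//; [lra|left].
move=> s /=; have [qs|sq] := ltP q s.
  rewrite bump_out//; last by right.
  by have [? H] := lamP s; split => // /andP[ps sl]; apply: H; rewrite sl ltW.
rewrite lam_id; last exact: bump_q.
have [sp|ps] := leP s p.
  rewrite bump_out//; last by left.
  rewrite subrr normr0; split=> // /andP[ps _].
  by rewrite (_ : s = p)//; apply/eqP; rewrite eq_le sp ps.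
have [sa|as_] := leP s a.
  have [_ [/andP[h1 h2] h3]] := bump_left q pa pb ps sa.
  split; first by rewrite ltr_norml; lra.
  move=> _; move: sa; rewrite le_eqVlt => /orP[/eqP sa|sa].
    have -> : bump p a b q s = b.
      have sa' : s <= a by rewrite sa.
      have [-> _] := bump_left q pa pb ps sa'.
      by rewrite sa mulrC divfK; [lra|rewrite subr_eq0 gt_eqF].
    by rewrite ua2 ?vb2 ?uq//; lra.
  by rewrite ua1 ?vb1//; have := h3 sa; lra.
have [_ /andP[h1 h2]] := bump_right pa aq bq as_ sq.
split; first by rewrite ltr_norml; lra.
by move=> _; rewrite ua2 ?vb2 ?uq//; lra.
Qed.

(** Choose the rational times one after the other, at a distance between h / 2 and
    h of the previous one, where h is at most e and so small that the path has at
    most one jump in each interval of length h.  Two candidates are enough, as they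
    cannot both be the jump time. *)
Lemma step_path_cells (R : realType) (V : Type) (u : R -> V) (T e : R) :
  step_path u -> 0 < T -> 0 < e ->
  exists l : seq (rat * V), let l' := [seq (ratr qz.1, qz.2) | qz <- l] in
    [/\ mesh e 0 (map fst l'), cells u 0 l' & T <= last 0 (map fst l')].
Proof.
move=> su T0 e0; have [d d0 H] := step_path_one_jump T su.
pose h := Num.min d e.
have h0 : 0 < h by rewrite lt_min d0.
have [hd he] : h <= d /\ h <= e by rewrite !ge_min !lexx orbT.
suff chain n (p : rat) : 0 <= p -> T <= ratr p + n%:R * (h / 2) ->
    exists l : seq (rat * V), let l' := [seq (ratr qz.1, qz.2) | qz <- l] in
    [/\ mesh e (ratr p) (map fst l'), cells u (ratr p) l' &
        T <= last (ratr p) (map fst l')].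
  have := chain (Num.bound (T / (h / 2))) 0 (lexx 0); rewrite rmorph0 add0r.
  apply; rewrite -ler_pdivrMr; last by lra.
  by apply/ltW/archi_boundP; rewrite divr_ge0; lra.
elim: n p => [|n IH] p p0; first by rewrite mul0r addr0 => Tp; exists [::].
rewrite -natr1 mulrDl mul1r => Tp.
have [pT|Tp'] := leP (ratr p) T; last by exists [::]; split => //=; exact: ltW.
have rp0 : 0 <= ratr p :> R by rewrite ler0q.
have [q2 /andP[q2l q2u]] : exists q2 : rat, ratr p + h / 2 < ratr q2 < ratr p + h.
  by apply: rat_between; lra.
have [q1 /andP[q1l q12]] : exists q1 : rat, ratr p + h / 2 < (ratr q1 : R) < ratr q2.
  by apply: rat_between; lra.
have [q [ql qu qj]] : exists q : rat, [/\ ratr p + h / 2 < ratr q,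
    ratr q < ratr p + h & inner_jump u (ratr p) (ratr q)].
  have [||tau [/andP[ptau tauq] H1 H2]] := H (ratr p) (ratr q2); [lra|lra|].
  have [tq1|q1t|tq1] := ltgtP tau (ratr q1).
  - exists q1; split=> //; first by lra.
    exists tau; split=> //; first by rewrite ptau.
    by move=> s sq; rewrite H2 ?(H2 (ratr q1)) //; lra.
  - exists q1; split=> //; first by lra.
    exists ((ratr p + ratr q1) / 2); split; first by lra.
    + by move=> s sq; rewrite H1//; lra.
    + by move=> s sq; rewrite H1 ?(H1 (ratr q1))//; lra.
  - exists q2; split=> //.
    by exists tau; split=> //; rewrite ptau tq1.
have [||l [/= ml cl Tl]] := IH q.
- by rewrite -(ler0q R); lra.
- by move: (n%:R * (h / 2)) Tp ql => x; lra.
exists ((q, u (ratr q)) :: l) => /=; split=> //; split=> //; lra.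
Qed.

(** * Borel maps into the Skorohod space of configuration paths *)

Definition restrict_path (R : realType) (S : countType) (F : seq S)
  (w : cadlag R (config S)) (t : R) : seq bool := [seq w t x | x <- F].

Lemma step_restrict_path (R : realType) (S : countType) (F : seq S)
  (w : cadlag R (config S)) : step_path (restrict_path F w).
Proof.
apply: step_path_map => x.
by apply: (@cadlag_step _ _ _ (fun z : config S => z x)) => z; exact: nbhs_config_coord.
Qed.

(** The paths with a prescribed record i: sites, their states at time 0, then
    rational times with the states of the sites at these times, at most one jump
    being allowed between consecutive times. *)
Definition skorohod_cell (R : realType) (S : countType)
    (i : seq S * seq bool * seq (rat * seq bool)) : set (cadlag R (config S)) :=
  [set w | restrict_path i.1.1 w 0 = i.1.2 /\
     cells (restrict_path i.1.1 w) 0 [seq (ratr qz.1, qz.2) | qz <- i.2]].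

Lemma skorohod_open_cell (R : realType) (S : countType)
    (U : set (cadlag R (config S))) (w : cadlag R (config S)) :
  skorohod_open U -> U w ->
  exists2 i, @skorohod_cell R S i `<=` U & skorohod_cell i w.
Proof.
move=> oU /oU[T [e [E [T0 e0 /config_entourage_cylinder[F FE] sU]]]].
have [l [ml cl Tl]] := step_path_cells (step_restrict_path F w) T0 e0.
exists (F, restrict_path F w 0, l) => // v [/= v0 cv]; apply: sU.
have [lam [mal [K1 K2 lam_lt lam_id lamP]]] :=
  cells_time_change e0 ml (esym v0) cl cv.
have lam0 : lam 0 = 0 by exact: lam_id.
exists lam.
  split; last by move=> s t _ _; exact: lam_lt.
  split.
  - move=> s /=; rewrite !in_itv /= !andbT le_eqVlt => /orP[/eqP<-|s0].
      by rewrite lam0.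
    by rewrite -lam0 ltW// lam_lt.
  - by move=> s t _ _; exact: (can_inj K1).
  - move=> s /=; rewrite in_itv /= andbT => s0; exists (mal s); last exact: K2.
    rewrite /= in_itv /= andbT leNgt; apply/negP => /lam_lt.
    by rewrite K2 lam0 ltNge s0.
move=> s /andP[s0 sT]; have [? H] := lamP s; split=> //; apply: FE.
apply/eq_in_map; apply: H; rewrite s0 /=; exact: le_trans Tl.
Qed.

Section MeasurableSkorohod.
Context d (T : measurableType d) (R : realType) (V : countType) (u : T -> R -> V).
Hypothesis su : forall w, step_path (u w).
Hypothesis mu : forall t v, 0 <= t -> measurable [set w | u w t = v].

Let measurable_eq2 (s t : R) : 0 <= s -> 0 <= t ->
  measurable [set w | u w s = u w t].
Proof.
move=> s0 t0.
apply: (@event_iff _ _ (fun w => exists v, u w s = v /\ u w t = v)).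
  by move=> w; split=> [->|[v [-> ->]]//]; exists (u w t).
by apply: event_exists => v; exact: (event_and (mu v s0) (mu v t0)).
Qed.

Lemma measurable_inner_jump (p q : rat) : 0 <= p -> p < q ->
  measurable [set w | inner_jump (u w) (ratr p) (ratr q)].
Proof.
move=> p0 pq.
have r0 (s : rat) : p <= s -> 0 <= ratr s :> R.
  by move=> ps; rewrite ler0q (le_trans p0).
apply: (@event_iff _ _ (fun w => rat_inner_jump (u w) p q)).
  by move=> w; exact: inner_jump_ratP.
apply: event_and.
  apply: event_exists => q'; have [/andP[pq' q'q]|nq'] := boolP (p < q' < q).
    apply: event_and; first exact: event_prop.
    apply: event_forall => s; apply: event_imp => /andP[q's sq].
    by apply: measurable_eq2; apply: r0; rewrite ?(le_trans (ltW pq'))// ltW.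
  by apply: (@event_iff _ _ (fun _ => False));
    [move=> w; split=> // -[]|exact: event_prop].
apply: event_forall => s; apply: event_forall => s'.
apply: event_imp => ps; apply: event_imp => ss'.
apply: event_imp => s'q.
have ps' : p <= s' by rewrite (le_trans ps)// ltW.
have pq' := ltW pq.
by apply: event_or; apply: measurable_eq2; apply: r0.
Qed.

Lemma measurable_cells (p : rat) (l : seq (rat * V)) : 0 <= p ->
  measurable [set w | cells (u w) (ratr p) [seq (ratr qz.1, qz.2) | qz <- l]].
Proof.
elim: l p => [|[q z] l IH] p p0 /=; first exact: event_prop.
have [pq|qp] := ltP p q.
  have q0 : 0 <= q by rewrite (le_trans p0)// ltW.
  apply: (@event_iff _ _ (fun w => inner_jump (u w) (ratr p) (ratr q) /\
    (u w (ratr q) = z /\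
     cells (u w) (ratr q) [seq (ratr qz.1, qz.2) | qz <- l]))).
    by move=> w; split=> [[]|[? []]].
  apply: event_and; first exact: measurable_inner_jump.
  by apply: event_and; [apply: mu; rewrite ler0q|exact: IH].
apply: (@event_iff _ _ (fun _ => False)); last exact: event_prop.
move=> w; split=> // -[[tau [/andP[ptau tauq] _ _]] _ _].
by move: (lt_trans ptau tauq); rewrite ltr_rat ltNge qp.
Qed.
End MeasurableSkorohod.

(** A Skorohod open set is the union of the cells it contains, and there are
    countably many cells, each described by evaluations. *)
Lemma measurable_fun_skorohod d (T : measurableType d) (R : realType)
    (S : countType) (X : T -> cadlag R (config S)) :
  (forall t x b, 0 <= t -> measurable [set w | X w t x = b]) ->
  measurable_fun [set: T] (X : T -> borel (cadlag R (config S))).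
Proof.
move=> mX; apply: (@measurable_fun_generated _ T (cadlag R (config S))) => U oU.
apply: (@event_iff _ _ (fun w => exists i, @skorohod_cell R S i `<=` U /\
  skorohod_cell i (X w))).
  move=> w; split=> [Uw|[i [iU]]]; last exact: iU.
  by have [i iU iw] := skorohod_open_cell oU Uw; exists i.
apply: event_exists => -[[F z] l].
have mF t v : 0 <= t -> measurable [set w | restrict_path F (X w) t = v].
  by move=> t0; apply: event_eq_map => x b; exact: mX.
apply: event_and; first exact: event_prop.
apply: event_and; first exact: mF.
have := @measurable_cells _ T R _ (fun w => restrict_path F (X w)) _ mF 0 l (lexx 0).
by rewrite rmorph0; apply => w; exact: step_restrict_path.
Qed.

Lemma measurable_open_config d (T : measurableType d) (S : countType)
    (X : T -> config S) (U : set (config S)) :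
  (forall x b, measurable [set w | X w x = b]) -> open U ->
  measurable [set w | U (X w)].
Proof.
move=> mX oU.
apply: (@event_iff _ _ (fun w => exists i : seq S * seq bool,
  (forall z : config S, [seq z x | x <- i.1] = i.2 -> U z) /\
  [seq X w x | x <- i.1] = i.2)).
  move=> w; split=> [Uw|[i [iU]]]; last exact: iU.
  have /nbhs_config_cylinder[F FU] : nbhs (X w) U by exact: open_nbhs_nbhs.
  exists (F, [seq X w x | x <- F]); split=> //= z zw.
  by apply: FU => x xF; move/eq_in_map: zw => ->.
apply: event_exists => i; apply: event_and; first exact: event_prop.
exact: event_eq_map.
Qed.

(** * The event carrying the graphical construction *)

Definition left_value (R : realType) (V : Type) (u : R -> V) (t : R) (v : V) :=
  exists2 d, 0 < d & forall s, t - d < s < t -> u s = v.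

(** The operator [lim] carries no information until convergence is known; here the
    path is constant just before t. *)
Lemma left_lim_value (R : realType) (w : cadlag R nat) (t : R) (v : nat) :
  left_value w t v -> left_lim w t = v.
Proof.
move=> [d d0 H]; apply: cvg_lim; first exact: discrete_hausdorff.
have wv : \forall s \near t^'-, w s = v.
  have td : t - d < t by rewrite ltrBlDr ltrDl.
  near=> s; apply: H; apply/andP; split; near: s.
    exact: nbhs_left_gt.
  exact: nbhs_left_lt.
move=> A Av; suff : \forall s \near t^'-, A (w s) by [].
by apply: filterS wv => s ->; exact: nbhs_singleton Av.
Unshelve. all: by end_near. Qed.

Lemma step_cadlag_nat (R : realType) (w : cadlag R nat) : step_path w.
Proof.
apply: (@cadlag_step _ nat _ id) => a; change (nbhs a [set b | b = a]).
by rewrite nbhs_principalE; exact/principal_filterP.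
Qed.

Lemma one_jump_left_value (R : realType) (V : Type) (u : R -> V) (p q : R) :
  one_jump u p q -> exists2 tau, p < tau <= q & left_value u tau (u p) /\ u tau = u q.
Proof.
move=> [tau [/andP[pt tq] H K]]; exists tau; rewrite ?pt//; split.
  by exists (tau - p); [rewrite subr_gt0|move=> s sp; apply: H; lra].
by apply: K; rewrite lexx.
Qed.

(** A condition on the values before and after each jump is tested on short
    intervals with rational end points: such an interval around a jump sees the
    two values, and no other values when it is short enough. *)
Lemma jump_relationP (R : realType) (V : Type) (u : R -> V) (Phi : V -> V -> Prop) :
  step_path u ->
  (forall t v, 0 < t -> left_value u t v -> Phi v (u t)) <->
  (forall T : nat, exists n : nat, forall p q : rat,
     0 <= p -> p < q -> ratr q < ratr p + n.+1%:R^-1 :> R -> ratr p <= T%:R :> R ->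
     Phi (u (ratr p)) (u (ratr q))).
Proof.
move=> su; split=> [H T|H t v t0 [d d0 Hd]].
  have [d d0 oneJ] := step_path_one_jump T%:R su.
  have [n nd] := natSinv_lt d0; exists n => p q p0 pq qp pT.
  have rp0 : 0 <= ratr p :> R by rewrite ler0q.
  have [||tau /andP[pt tq] [lv <-]] := one_jump_left_value (oneJ (ratr p) (ratr q) _ _).
  - by rewrite rp0.
  - by rewrite ltr_rat pq (lt_trans qp)// ltrD2l.
  - by apply: H => //; exact: le_lt_trans pt.
have [n {}H] := H (Num.bound t).
have [d' d'0 Hd'] := su.1 t (ltW t0).
have tT : t < (Num.bound t)%:R by apply: archi_boundP; exact: ltW.
have n0 : 0 < n.+1%:R^-1 :> R by rewrite invr_gt0 ltr0n.
move: n0 H; set h := n.+1%:R^-1 => n0 H.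
have [p] : exists p : rat, Num.max (Num.max (t - d) (t - h / 2)) 0 < ratr p < t.
  by apply: rat_between; rewrite !gt_max; lra.
rewrite !gt_max => /andP[/andP[/andP[pd ph] p0] pt].
have [q] : exists q : rat, t < ratr q < Num.min (t + d') (t + h / 2).
  by apply: rat_between; rewrite lt_min; lra.
rewrite lt_min => /and3P[tq qd qh].
rewrite -(Hd (ratr p)) ?pd ?pt// -(Hd' (ratr q)); last by rewrite ltW.
by apply: H; rewrite -?(ler0q R) -?(ltr_rat R); lra.
Qed.

Lemma event_jump_relation d (T : measurableType d) (R : realType) (V : countType)
    (u : T -> R -> V) (Phi : V -> V -> Prop) :
  (forall w, step_path (u w)) ->
  (forall t v, 0 <= t -> measurable [set w | u w t = v]) ->
  measurable [set w | forall t v, 0 < t -> left_value (u w) t v -> Phi v (u w t)].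
Proof.
move=> su mu; apply: (@event_iff _ _ _ _ (fun w => jump_relationP Phi (su w))).
apply: event_forall => N; apply: event_exists => n; apply: event_forall => p.
apply: event_forall => q; apply: event_imp => p0; apply: event_imp => pq.
apply: event_imp => _; apply: event_imp => _.
apply: (@event_iff _ _ (fun w => exists v v', Phi v v' /\
  (u w (ratr p) = v /\ u w (ratr q) = v'))).
  move=> w; split=> [?|[v [v' [? [-> ->]]]]//].
  by exists (u w (ratr p)), (u w (ratr q)).
apply: event_exists => v; apply: event_exists => v'.
have q0 : 0 <= q by rewrite (le_trans p0)// ltW.
apply: event_and; first exact: event_prop.
by apply: event_and; apply: mu; rewrite ler0q.
Qed.

(** The path increases across each short interval, as it has there at most one
    jump, which is upwards. *)
Lemma up_jumps_homo (R : realType) (w : cadlag R nat) :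
  (forall s, jump_times w s -> up_jump w s) ->
  forall s t, 0 <= s -> s <= t -> (w s <= w t)%N.
Proof.
move=> H s t s0 st.
have [d d0 oneJ] := step_path_one_jump t (step_cadlag_nat w).
have loc p q : 0 <= p <= t -> p < q < p + d -> (w p <= w q)%N.
  move=> /andP[p0 pt] pq; have := oneJ p q _ pq; rewrite p0 pt.
  move=> /(_ isT)/one_jump_left_value[tau /andP[ptau tauq] [lv <-]].
  have lE := left_lim_value lv.
  have [e|ne] := pselect (w tau = left_lim w tau); first by rewrite e lE.
  rewrite (H tau _) ?lE//; split=> //; exact: le_lt_trans ptau.
have d2 : 0 < d / 2 by lra.
have chain n p : s <= p -> p <= t -> t <= p + n%:R * (d / 2) -> (w p <= w t)%N.
  elim: n p => [|n IH] p sp pt.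
    by rewrite mul0r addr0 => tp; rewrite (le_anti (introT andP (conj pt tp))).
  rewrite -natr1 mulrDl mul1r => tn.
  have [tpd|pdt] := leP t (p + d / 2).
    move: pt; rewrite le_eqVlt => /orP[/eqP->//|pt].
    by apply: loc; lra.
  apply: (@leq_trans (w (p + d / 2))); first by apply: loc; lra.
  apply: IH; [lra|lra|].
  by move: (n%:R * (d / 2)) tn => x; lra.
apply: (chain (Num.bound ((t - s) / (d / 2)))) => //.
rewrite -lerBlDl -ler_pdivrMr//; apply/ltW/archi_boundP.
by rewrite divr_ge0; lra.
Qed.

(** This form quantifies over the finite subsets of the countable set S instead of
    the paths of the graph. *)
Lemma finite_componentsP (S : countType) (adj : S -> S -> Prop) :
  finite_components adj <-> forall x, exists F : seq S,
    x \in F /\ forall y z, y \in F -> adj y z -> z \in F.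
Proof.
split=> [H x|H x].
  have /finite_seqP[F CF] := H x.
  have FE y : (y \in F) <-> component adj x y by rewrite CF.
  exists F; split; first by apply/FE; exact: rt_refl.
  by move=> y z /FE xy yz; apply/FE; apply: rt_trans xy _; exact: rt_step.
have [F [xF FF]] := H x; apply: (sub_finite_set _ (finite_seq F)) => y /= xy.
elim: xy xF => {x y} [y z yz yF|//|x y z _ IH1 _ IH2 xF]; first exact: FF yz.
by apply: IH2; exact: IH1.
Qed.

(** The uniform bound is on sums over finite sequences, which are countably many. *)
Lemma esum_nat_lt_pinfty (R : realType) (I : countType) (A : set I) (a : I -> nat) :
  (\esum_(i in A) ((a i)%:R : R)%:E < +oo)%E <->
  exists M : nat, forall F : seq I, uniq F -> (forall i, i \in F -> A i) ->
    (sumn [seq a i | i <- F] <= M)%N.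
Proof.
have sumE (F : seq I) : (\sum_(i <- F) ((a i)%:R : R)%:E =
    ((sumn [seq a i | i <- F])%:R : R)%:E)%E.
  by elim: F => [|i F IH]; rewrite ?big_nil// big_cons IH /= natrD EFinD.
split=> [H|[M H]].
  have H0 : (0 <= \esum_(i in A) ((a i)%:R : R)%:E)%E.
    by apply: esum_ge0 => i _; rewrite lee_fin.
  move: H H0; case E : (esum _ _) => [r| |]//= _; rewrite lee_fin => r0.
  exists (Num.bound r) => F uF FA; rewrite -(ler_nat R).
  apply: ltW; apply: le_lt_trans (archi_boundP r0); rewrite -lee_fin -E -sumE.
  apply: esum_ge; exists [set` F]; last by rewrite fsbig_seq.
  by split; [exact: finite_seq|move=> i /= /FA].
apply: (@le_lt_trans _ _ (M%:R : R)%:E); last by rewrite ltry.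
apply: ub_ereal_sup => _ [B [finB BA] <-].
rewrite fsbig_finite//= sumE lee_fin ler_nat; apply: H => [|i]; first exact: fset_uniq.
by rewrite in_fset_set// inE => /BA.
Qed.

Section GammaStar.
Context (R : realType) (S : countType).
Implicit Types K : paths R S.

Lemma event_paths_seq (F : seq (edge S)) (t : R) (l : seq nat) : 0 <= t ->
  measurable ([set K | [seq (K : paths R S) e t | e <- F] = l] :
    set (borel (paths R S))).
Proof. by move=> t0; apply: event_eq_map => e v; exact: measurable_paths_eval. Qed.

Lemma event_Ksym (e : edge S) (t : R) (k : nat) : 0 <= t ->
  measurable ([set K | Ksym K e t = k] : set (borel (paths R S))).
Proof.
move=> t0; apply: (@event_iff _ (borel (paths R S)) (fun K => exists a b : nat,
  (a + b = k)%N /\ ((K : paths R S) e t = a /\ (K : paths R S) (rev_edge e) t = b))).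
  move=> K; split=> [<-|[a [b [<- [<- <-]]]]//].
  by exists ((K : paths R S) e t), ((K : paths R S) (rev_edge e) t).
apply: event_exists => a; apply: event_exists => b.
apply: event_and; first exact: event_prop.
by apply: event_and; exact: measurable_paths_eval.
Qed.

Lemma event_graph (s t : R) (x y : S) : 0 <= s -> 0 <= t ->
  measurable ([set K | graph K s t x y] : set (borel (paths R S))).
Proof.
move=> s0 t0; apply: (@event_iff _ (borel (paths R S)) (fun K => exists (e : edge S)
  (a b : nat), (val e = (x, y) /\ (a < b)%N) /\
    (Ksym (K : paths R S) e s = a /\ Ksym (K : paths R S) e t = b))).
  move=> K; split=> [[e exy ab]|[e [a [b [[exy ab] [ea eb]]]]]].
    by exists e, (Ksym (K : paths R S) e s), (Ksym (K : paths R S) e t).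
  by exists e => //; rewrite ea eb.
apply: event_exists => e; apply: event_exists => a; apply: event_exists => b.
apply: event_and; first exact: event_prop.
by apply: event_and; exact: event_Ksym.
Qed.

Lemma event_finite_components (s t : R) : 0 <= s -> 0 <= t ->
  measurable ([set K | finite_components (graph K s t)] :
    set (borel (paths R S))).
Proof.
move=> s0 t0.
apply: (@event_iff _ (borel (paths R S)) _ _ (fun K => finite_componentsP _)).
apply: event_forall => x; apply: event_exists => F.
apply: event_and; first exact: event_prop.
apply: event_forall => y; apply: event_forall => z; apply: event_imp => _.
apply: (@event_iff _ (borel (paths R S)) (fun K => ~ graph K s t y z \/ z \in F)).
  move=> K; split=> [H|[//|//]]; have [zF|zF] := boolP (z \in F); first by right.
  by left=> /H zF'; rewrite zF' in zF.
apply: event_or; last exact: event_prop.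
by apply: event_not; exact: event_graph.
Qed.

Definition disjoint_jumps K := forall e e' : edge S, e <> e' ->
  jump_times (K e) `&` jump_times (K e') = set0.

Definition unit_jumps K := forall (e : edge S) s, jump_times (K e) s -> up_jump (K e) s.

Lemma left_value_ex (w : cadlag R nat) (t : R) : 0 < t -> left_value w t (left_lim w t).
Proof.
move=> t0; have [d d0 [v H]] := (step_cadlag_nat w).2 t t0.
have lv : left_value w t v by exists d.
by rewrite (left_lim_value lv).
Qed.

Lemma event_disjoint_jumps :
  measurable ([set K | disjoint_jumps K] : set (borel (paths R S))).
Proof.
apply: event_forall => e; apply: event_forall => e'; apply: event_imp => _.
pose u K (t : R) := [seq K f t | f <- [:: e; e']].
pose Phi (l l' : seq nat) := nth 0%N l 0 = nth 0%N l' 0 \/ nth 0%N l 1 = nth 0%N l' 1.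
apply: (@event_iff _ (borel (paths R S))
  (fun K => forall t v, 0 < t -> left_value (u K) t v -> Phi v (u K t))).
  move=> K; split=> [H t v t0 [d d0 Hd]|H].
    have vE f i : nth e [:: e; e'] i = f -> (i < 2)%N ->
        left_lim ((K : paths R S) f) t = nth 0%N v i.
      move=> fi i2; apply: left_lim_value; exists d => // s /Hd <-.
      by rewrite /u (nth_map e)// fi.
    rewrite /Phi /= -(vE e 0%N)// -(vE e' 1%N)//.
    have [->|ne] := pselect (left_lim ((K : paths R S) e) t = (K : paths R S) e t);
      first by left.
    have [->|ne'] := pselect (left_lim ((K : paths R S) e') t = (K : paths R S) e' t);
      first by right.
    suff : (set0 : set R) t by [].
    by rewrite -H; split; split=> //; apply: nesym.
  rewrite -subset0 => t [[t0 ne] [_ ne']].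
  have [d d0 Hd] := left_value_ex ((K : paths R S) e) t0.
  have [d' d'0 Hd'] := left_value_ex ((K : paths R S) e') t0.
  have lv : left_value (u K) t
      [:: left_lim ((K : paths R S) e) t; left_lim ((K : paths R S) e') t].
    exists (Num.min d d'); first by rewrite lt_min d0.
    move=> s /andP[]; rewrite ltrBlDr -ltrBlDl lt_min => /andP[sd sd'] st.
    by rewrite /u /= Hd ?Hd'//; lra.
  by case: (H _ _ t0 lv) => /= /esym.
apply: event_jump_relation.
  by move=> K; apply: step_path_map => f; exact: step_cadlag_nat.
by move=> t v t0; exact: event_paths_seq.
Qed.

Lemma event_unit_jumps :
  measurable ([set K | unit_jumps K] : set (borel (paths R S))).
Proof.
apply: event_forall => e.
apply: (@event_iff _ (borel (paths R S)) (fun K => forall t v, 0 < t ->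
  left_value ((K : paths R S) e) t v ->
  (fun a b => b = a \/ b = a.+1) v ((K : paths R S) e t))).
  move=> K; split=> [H t v t0 /left_lim_value vE|H t [t0 ne]].
    have [->|ne] := pselect ((K : paths R S) e t = left_lim ((K : paths R S) e) t).
      by left.
    by right; rewrite -vE; apply: H.
  by have [|//] := H t _ t0 (left_value_ex ((K : paths R S) e) t0).
apply: (@event_jump_relation _ (borel (paths R S)) R _
  (fun K (t : R) => (K : paths R S) e t) (fun a b => b = a \/ b = a.+1)).
  by move=> K; exact: step_cadlag_nat.
by move=> t v t0; exact: measurable_paths_eval.
Qed.

(** The condition on the sums over the edges at x at all times reduces to integer
    times, since the counts are nondecreasing in time when all the jumps are upwards. *)
Lemma measurable_Gamma_star (t0 : R) : 0 <= t0 -> measurable (Gamma_star (S := S) t0).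
Proof.
move=> t0_ge0; apply: (@event_iff _ (borel (paths R S)) (fun K =>
  ((forall r : nat, Gamma_r t0 r K) /\ (disjoint_jumps K /\ unit_jumps K)) /\
  ((forall e : edge S, (K : paths R S) e 0 = 0%N) /\
   (forall (x : S) (n : nat), exists M : nat, forall F : seq (edge S),
      uniq F -> (forall e, e \in F -> src e = x) ->
      (sumn [seq Ksym (K : paths R S) e n%:R | e <- F] <= M)%N)))).
  move=> K; split.
    move=> [H1 H2 H3 H5]; split; split=> //; first by move=> r; exact: H1.
    move=> x n; exact/(@esum_nat_lt_pinfty R _ [set e | src e = x])/H2.
  move=> [[H1 [H3 H4]] [H5 H2]]; split=> // x t t_ge0.
  have /(@esum_nat_lt_pinfty R _ [set e | src e = x]) := H2 x (Num.bound t).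
  apply: le_lt_trans; apply: le_esum => e _; rewrite lee_fin ler_nat leq_add//;
    by (apply: up_jumps_homo; [move=> s; exact: H4|by []|apply/ltW/archi_boundP]).
have r0 (r : nat) : 0 <= r%:R * t0 by rewrite mulr_ge0.
apply: (@event_and _ (borel (paths R S))); apply: (@event_and _ (borel (paths R S))).
- by apply: event_forall => r; exact: event_finite_components.
- by apply: event_and; [exact: event_disjoint_jumps|exact: event_unit_jumps].
- by apply: event_forall => e; exact: measurable_paths_eval.
apply: event_forall => x; apply: event_forall => n; apply: event_exists => M.
apply: event_forall => F; apply: event_imp => _; apply: event_imp => _.
apply: (@event_comp_pred _ (borel (paths R S)) _
  (fun K => [seq Ksym (K : paths R S) e n%:R | e <- F]) (fun l => (sumn l <= M)%N)).
by move=> l; apply: event_eq_map => e v; exact: event_Ksym.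
Qed.

End GammaStar.

(** * Evolution inside one finite component *)

Definition firing (S : countType) (C : set S) (E : set (edge S)) (z : config S) :
    set (edge S) :=
  [set e | [/\ C (src e), C (dst e), E e, z (src e) & ~~ z (dst e)]].

(** The common form of the two updates that are compared below: the edges of E that
    fire are those with a jump at a given time, or those whose count
    changes between two given times. *)
Definition fire (S : countType) (C : set S) (E : set (edge S)) (z : config S) :
    config S := fun x =>
  if `[< exists2 e, firing C E z e & src e = x >] then false
  else if `[< exists2 e, firing C E z e & dst e = x >] then true
  else z x.

Lemma moveE (R : realType) (S : countType) (K : paths R S) (C : set S)
  (z : config S) (s : R) : move K C z s = fire C (fun e => up_jump (K e) s) z.
Proof. by []. Qed.

Lemma eq_fire (S : countType) (C : set S) (E E' : set (edge S)) (z : config S) :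
  (forall e, C (src e) -> C (dst e) -> E e <-> E' e) -> fire C E z = fire C E' z.
Proof.
move=> EE'; rewrite /fire (_ : firing C E z = firing C E' z)//.
by apply/seteqP; split=> e [cs cd /EE' Ee ? ?]; split=> //; exact: Ee.
Qed.

Lemma fire_none (S : countType) (C : set S) (E : set (edge S)) (z : config S) :
  (forall e, C (src e) -> C (dst e) -> ~ E e) -> fire C E z = z.
Proof.
move=> nE; apply/funext => x; rewrite /fire.
by case: asboolP => [[e [/nE h /h]]//|_]; case: asboolP => [[e [/nE h /h]]//|_].
Qed.

Lemma fire_local (S : countType) (C : set S) (E : set (edge S)) (z z' : config S) :
  (forall x, C x -> z x = z' x) -> forall x, C x -> fire C E z x = fire C E z' x.
Proof.
move=> zz' x Cx; rewrite /fire zz'// (_ : firing C E z = firing C E z')//.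
apply/seteqP; split=> e [cs cd Ee zs zd]; split=> //.
- by rewrite -zz'.
- by rewrite -zz'.
- by rewrite zz'.
- by rewrite zz'.
Qed.

Lemma event_fire d (T : measurableType d) (S : countType) (C : set S)
    (E : T -> set (edge S)) (Z : T -> config S) :
  (forall e, measurable [set w | E w e]) ->
  (forall x b, measurable [set w | Z w x = b]) ->
  forall x b, measurable [set w | fire C (E w) (Z w) x = b].
Proof.
move=> mE mZ x b.
pose jumps (f : edge S -> S) w := exists e : edge S, (C (src e) /\ C (dst e)) /\ E w e /\
  (Z w (src e) = true /\ Z w (dst e) = false) /\ f e = x.
have mj f : measurable [set w | jumps f w].
  apply: event_exists => e; apply: event_and; first exact: event_prop.
  apply: event_and => //; apply: event_and; last exact: event_prop.
  by apply: event_and.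
have jE f w : (exists2 e, firing C (E w) (Z w) e & f e = x) <-> jumps f w.
  split=> [[e [? ? ? ? /negbTE] ? ?]|[e [[? ?] [? [[? zd] ?]]]]].
    by exists e.
  by exists e => //; split=> //; rewrite zd.
apply: (@event_iff _ _ (fun w => (jumps (@src S) w /\ b = false) \/
  (~ jumps (@src S) w /\ ((jumps (@dst S) w /\ b = true) \/
     (~ jumps (@dst S) w /\ Z w x = b))))).
  move=> w; rewrite /fire.
  case: asboolP => /jE js; first by split=> [<-|[[]|[]//]]; [left|].
  case: asboolP => /jE jd.
    by split=> [<-|[[]//|[_ [[_ ->]//|[]//]]]]; right; split=> //; left.
  by split=> [zb|[[]//|[_ [[]//|[]//]]]]; right; split=> //; right.
apply: event_or; first by apply: event_and; [exact: mj|exact: event_prop].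
apply: event_and; first by apply: event_not; exact: mj.
apply: event_or; first by apply: event_and; [exact: mj|exact: event_prop].
by apply: event_and; [apply: event_not; exact: mj|exact: mZ].
Qed.

Section Evolution.
Context (R : realType) (S : countType) (K : paths R S).
Hypothesis uK : unit_jumps K.

Definition edges_in (F : seq S) : seq (edge S) :=
  pmap insub [seq (x, y) | x <- F, y <- F].

Lemma mem_edges_in (F : seq S) (e : edge S) :
  (e \in edges_in F) = (src e \in F) && (dst e \in F).
Proof.
rewrite mem_pmap_sub /=; apply/allpairsP/andP => [[[x y] [xF yF exy]]|[sF dF]].
  have -> : src e = x by exact: (congr1 fst exy).
  by have -> : dst e = y by exact: (congr1 snd exy).
by exists (src e, dst e); split=> //; rewrite /src /dst -surjective_pairing.
Qed.

Definition edge_counts (F : seq S) (s : R) : seq nat := [seq K e s | e <- edges_in F].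

Lemma step_edge_counts (F : seq S) : step_path (edge_counts F).
Proof. by apply: step_path_map => e; exact: step_cadlag_nat. Qed.

Lemma edge_counts_eq (F : seq S) (s t : R) (e : edge S) :
  edge_counts F s = edge_counts F t -> src e \in F -> dst e \in F -> K e s = K e t.
Proof. by move=> /eq_in_map H sF dF; apply: H; rewrite mem_edges_in sF. Qed.

Definition jumps_in (F : seq S) (p q s : R) :=
  p < s <= q /\ exists e : edge S, [/\ src e \in F, dst e \in F & up_jump (K e) s].

Lemma no_up_jump (F : seq S) (p s : R) (e : edge S) :
  p < s -> (forall s', p <= s' <= s -> edge_counts F s' = edge_counts F s) ->
  src e \in F -> dst e \in F -> ~ up_jump (K e) s.
Proof.
move=> ps H sF dF; rewrite /up_jump (@left_lim_value _ _ _ (K e s)).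
  by move=> /eqP; rewrite -{1}[K e s]addn0 -addn1 eqn_add2l.
exists (s - p); first by rewrite subr_gt0.
by move=> s' ss'; apply: (@edge_counts_eq F) => //; apply: H; lra.
Qed.

(** In an interval with at most one jump of the counts, all the edges that jump do
    so at the same time, and they are the edges whose count changes. *)
Lemma one_jump_jumps_in (F : seq S) (p q : R) : 0 <= p -> p < q ->
  one_jump (edge_counts F) p q ->
  (forall s, ~ jumps_in F p q s) /\ edge_counts F p = edge_counts F q \/
  exists2 tau, (forall s, jumps_in F p q s <-> s = tau) &
    p < tau <= q /\
    forall e, src e \in F -> dst e \in F -> up_jump (K e) tau <-> K e p <> K e q.
Proof.
move=> p0 pq [tau [/[dup] ptq /andP[pt tq] H1 H2]].
have before s : p < s -> s < tau ->
    forall s', p <= s' <= s -> edge_counts F s' = edge_counts F s.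
  by move=> ps st s' s'ps; rewrite !H1//; lra.
have off s : jumps_in F p q s -> s = tau.
  move=> [/andP[ps sq] [e [sF dF]]].
  have [st|ts|//] := ltgtP s tau.
    by move/(no_up_jump ps (before _ ps st) sF dF).
  have ts' s' : tau <= s' <= s -> edge_counts F s' = edge_counts F s.
    by move=> s'ts; rewrite !H2//; lra.
  by move/(no_up_jump ts ts' sF dF).
have qE : edge_counts F tau = edge_counts F q by apply: H2; rewrite lexx.
have at_tau e : src e \in F -> dst e \in F ->
    up_jump (K e) tau <-> K e p <> K e q.
  move=> sF dF; rewrite -(edge_counts_eq qE sF dF).
  have lv : left_lim (K e) tau = K e p.
    apply: left_lim_value; exists (tau - p); first by rewrite subr_gt0.
    by move=> s ps; apply: (@edge_counts_eq F) => //; apply: H1; lra.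
  split=> [|ne]; first by rewrite /up_jump lv => -> /eqP;
    rewrite -{1}[K e p]addn0 -addn1 eqn_add2l.
  by apply: uK; split; [exact: le_lt_trans pt|rewrite lv; exact: nesym].
have [e|ne] := pselect (edge_counts F p = edge_counts F q).
  left; split=> // s js; have st := off _ js; rewrite st in js.
  by case: js => _ [f [sF dF /(at_tau _ sF dF)]]; rewrite (edge_counts_eq e sF dF).
right; exists tau => // s; split=> [/off//|->]; split=> //.
have [f fF nf] : exists2 f, f \in edges_in F & K f p <> K f q.
  apply: contrapT => nex; apply: ne; apply/eq_in_map => f fF.
  by apply: contrapT => nf; apply: nex; exists f.
move: fF; rewrite mem_edges_in => /andP[sF dF].
by exists f; split=> //; exact/at_tau.
Qed.

Section OneStep.
Context (t0 : R) (t0_gt0 : 0 < t0) (r : nat) (F : seq S) (z : config S).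
Let C := [set` F].
Let a := r%:R * t0.
Let b := r.+1%:R * t0.
Let a0 : 0 <= a. Proof. by rewrite mulr_ge0// ltW. Qed.
Let A := update_times t0 K r C.

Definition evolution (t : R) : config S :=
  foldl (move K C) z (sort <=%R (fset_set (update_times t0 K r C t))).

Lemma update_times_start (t : R) : t <= a -> A t = set0.
Proof.
by move=> ta; rewrite -subset0 => s [/andP[as_ _] st _]; move: as_; rewrite -/a; lra.
Qed.

Lemma update_timesU (p q : R) : a <= p -> p <= q -> q <= b ->
  A q = A p `|` [set s | jumps_in F p q s].
Proof.
move=> ap pq qb; apply/seteqP; split=> s /=.
  move=> [/andP[as_ sb] sq [e [? ? ?]]].
  have [sp|ps] := leP s p; [left|right].
    by split; [rewrite as_|by []|exists e].
  by split; [rewrite ps|exists e].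
case=> [[sab sp ?]|[/andP[ps sq] ?]]; split=> //; first exact: le_trans pq.
by rewrite (le_lt_trans ap)// (le_trans sq).
Qed.

Lemma evolution_start (t : R) : t <= a -> evolution t = z.
Proof. by move=> ta; rewrite /evolution -/A update_times_start// fset_set0. Qed.

Lemma evolution_const (p q : R) : a <= p -> p <= q -> q <= b ->
  (forall s, ~ jumps_in F p q s) -> evolution q = evolution p.
Proof.
move=> ap pq qb nj; rewrite /evolution -/A (update_timesU ap pq qb).
by rewrite (_ : [set s | _] = set0) ?setU0// -subset0 => s /nj.
Qed.

Lemma sort_rcons_max (B : set R) (tau : R) : finite_set B -> (forall s, B s -> s < tau) ->
  sort <=%R (fset_set (B `|` [set tau])) = rcons (sort <=%R (fset_set B)) tau.
Proof.
move=> finB Btau.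
have memB s : (s \in (fset_set B : seq R)) = (s \in B) by rewrite in_fset_set.
have finBt : finite_set (B `|` [set tau]) by rewrite finite_setU; split.
apply: le_sorted_eq.
- exact: sort_sorted (@le_total _ R) _.
- rewrite (sorted_pairwise le_trans) pairwise_rcons -(sorted_pairwise le_trans).
  rewrite (sort_sorted (@le_total _ R)) andbT; apply/allP => s.
  by rewrite mem_sort memB inE => /Btau/ltW.
apply: uniq_perm.
- by rewrite sort_uniq fset_uniq.
- rewrite rcons_uniq sort_uniq fset_uniq andbT mem_sort memB.
  by apply/negP; rewrite inE => /Btau; rewrite ltxx.
move=> s; rewrite mem_rcons inE !mem_sort memB in_fset_set//.
apply/idP/orP; rewrite !inE; first by case=> [|->]; [right|left].
by case=> [/eqP->|]; [right|left].
Qed.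

(** Crossing an interval with at most one jump appends at most one time to the
    sorted list of jump times, hence performs at most one more move. *)
Lemma evolution_step (p q : R) : a <= p -> p < q -> q <= b ->
  one_jump (edge_counts F) p q -> finite_set (A p) ->
  finite_set (A q) /\
  evolution q = fire C (fun e => K e p <> K e q) (evolution p).
Proof.
move=> ap pq qb oneJ finA; have AU := update_timesU ap (ltW pq) qb.
have [[nj pqE]|[tau jE [/andP[pt tq] tauE]]] := one_jump_jumps_in (le_trans a0 ap) pq oneJ.
  split.
    by rewrite AU (_ : [set s | _] = set0) ?setU0// -subset0 => s /nj.
  rewrite (evolution_const ap (ltW pq) qb nj) fire_none// => e sF dF; apply.
  exact: (edge_counts_eq pqE).
have {}AU : A q = A p `|` [set tau].
  by rewrite AU; congr setU; apply/seteqP; split=> s /jE.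
split; first by rewrite AU finite_setU; split.
rewrite /evolution -/(A q) -/(A p) AU sort_rcons_max//; last first.
  by move=> s [_ sp _]; exact: le_lt_trans pt.
rewrite foldl_rcons moveE; apply: eq_fire => e sF dF; exact: tauE.
Qed.

End OneStep.
End Evolution.

Fixpoint grid_evolution (R : realType) (S : countType) (K : paths R S) (C : set S)
    (z : config S) (a h : R) (n : nat) : config S :=
  if n is n'.+1 then
    fire C (fun e => K e (a + n'%:R * h) <> K e (a + n%:R * h))
      (grid_evolution K C z a h n')
  else z.

Lemma evolution_gridP (R : realType) (S : countType) (K : paths R S) (t0 : R)
    (r : nat) (F : seq S) (z : config S) (t : R) :
  unit_jumps K -> 0 < t0 -> r%:R * t0 < t -> t <= r.+1%:R * t0 ->
  exists N : nat, forall n, (N <= n)%N ->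
    evolution K t0 r F z t =
    grid_evolution K [set` F] z (r%:R * t0) ((t - r%:R * t0) / n.+1%:R) n.+1.
Proof.
move=> uK t0_gt0 at_ tb; set a := r%:R * t0; set b := r.+1%:R * t0.
have a0 : 0 <= a by rewrite mulr_ge0// ltW.
have ta0 : 0 < t - a by rewrite subr_gt0.
have [d d0 oneJ] := step_path_one_jump t (step_edge_counts K F).
have [N Nd] := natSinv_lt (divr_gt0 d0 ta0).
exists N => n Nn; set h := (t - a) / n.+1%:R.
have h0 : 0 < h by rewrite divr_gt0// ltr0n.
have hd : h < d.
  rewrite /h -(@ltr_pdivlMl _ (t - a))// mulrC; apply: le_lt_trans Nd.
  by rewrite lef_pV2 ?posrE ?ltr0n// ler_nat ltnS.
have tE : a + n.+1%:R * h = t by rewrite /h mulrC divfK ?pnatr_eq0// addrC subrK.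
suff chain m : (m <= n.+1)%N -> finite_set (update_times t0 K r [set` F] (a + m%:R * h)) /\
    evolution K t0 r F z (a + m%:R * h) = grid_evolution K [set` F] z a h m.
  by rewrite -[in LHS]tE; exact: (chain n.+1 (leqnn _)).2.
elim: m => [_|m IH mn].
  rewrite mul0r addr0; split; last by rewrite evolution_start.
  by rewrite update_times_start.
rewrite [grid_evolution _ _ _ _ _ m.+1]/=; have [fin <-] := IH (ltnW mn).
have mh0 : 0 <= m%:R * h by rewrite mulr_ge0// ltW.
have mE : a + m.+1%:R * h = a + m%:R * h + h by rewrite -natr1 mulrDl mul1r addrA.
have mt : a + m.+1%:R * h <= t.
  by rewrite -[leRHS]tE lerD2l ler_wpM2r ?ler_nat// ltW.
apply: evolution_step => //.
- by rewrite lerDl.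
- by rewrite mE ltrDl.
- exact: le_trans tb.
- by apply: oneJ; move: mt; rewrite mE; move: (m%:R * h) mh0 => x; lra.
Qed.

Lemma event_grid_evolution d (T : measurableType d) (R : realType) (S : countType)
    (K : T -> paths R S) (C : set S) (Z : T -> config S) (a h : R) (n : nat) :
  (forall e t k, 0 <= t -> measurable [set w | K w e t = k]) ->
  (forall x b, measurable [set w | Z w x = b]) ->
  0 <= a -> 0 <= h ->
  forall x b, measurable [set w | grid_evolution (K w) C (Z w) a h n x = b].
Proof.
move=> mK mZ a0 h0; elim: n => [//|n IH] x b /=.
have p0 (m : nat) : 0 <= a + m%:R * h by rewrite addr_ge0// mulr_ge0.
apply: event_fire IH _ _ => e; apply: event_not.
apply: (@event_iff _ _ (fun w => exists k, K w e (a + n%:R * h) = k /\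
  K w e (a + n.+1%:R * h) = k)).
  by move=> w; split=> [->|[k [-> ->]]//]; exists (K w e (a + n.+1%:R * h)).
by apply: event_exists => k; apply: event_and; exact: mK.
Qed.

(** * The graphical construction as a random path *)

Section Eta.
Context (R : realType) (S : countType) (t0 : R) (t0_gt0 : 0 < t0).
Implicit Types (K : paths R S) (sigma : config S).

Lemma Gamma_star_component K (r : nat) (x : S) : Gamma_star t0 K ->
  exists F : seq S, component (graph_r t0 K r) x = [set` F].
Proof. by move=> [fc _ _ _]; apply/finite_seqP; exact: (fc r I). Qed.

Lemma Gamma_star_unit_jumps K : Gamma_star t0 K -> unit_jumps K.
Proof. by move=> [_ _ [_ uK] _]. Qed.

Lemma evolveE K (r : nat) (z : config S) (t : R) (x : S) (F : seq S) :
  component (graph_r t0 K r) x = [set` F] ->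
  evolve t0 K r z t x = evolution K t0 r F z t x.
Proof. by rewrite /evolve => ->. Qed.

(** A finite component is the smallest finite set that contains x and is closed
    under adjacency.  This expresses an equality of sets by countable
    quantifiers. *)
Lemma component_closureP (adj : S -> S -> Prop) (x : S) (F : seq S) :
  let closed_at (G : seq S) := x \in G /\ forall y z, y \in G -> adj y z -> z \in G in
  component adj x = [set` F] <->
  closed_at F /\ forall G : seq S, closed_at G -> forall y, y \in F -> y \in G.
Proof.
move=> closed_at.
have sub G : closed_at G -> component adj x `<=` [set` G].
  move=> [xG clG] y /= xy; elim: xy xG => {y} [y z yz yG|//|y z w _ IH1 _ IH2 yG].
    exact: clG yz.
  by apply: IH2; exact: IH1.
split=> [CF|[clF minF]].
  have FE y : (y \in F) <-> component adj x y by rewrite CF.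
  split=> [|G clG y /FE]; last exact: sub.
  split; first by apply/FE; exact: rt_refl.
  by move=> y z /FE xy yz; apply/FE; apply: rt_trans xy _; exact: rt_step.
apply/seteqP; split; first exact: sub.
have /finite_seqP[G CG] : finite_set (component adj x).
  by apply: sub_finite_set (sub _ clF) _; exact: finite_seq.
have GE y : (y \in G) <-> component adj x y by rewrite CG.
move=> y /= yF; apply/GE/minF => //; split; first by apply/GE; exact: rt_refl.
by move=> u v /GE xu uv; apply/GE; apply: rt_trans xu _; exact: rt_step.
Qed.

Lemma event_component (r : nat) (x : S) (F : seq S) :
  measurable ([set K | component (graph_r t0 K r) x = [set` F]] :
    set (borel (paths R S))).
Proof.
apply: (@event_iff _ (borel (paths R S)) _ _ (fun K => component_closureP _ _ _)).
have m_closed (G : seq S) : measurable ([set K | x \in G /\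
    forall y z, y \in G -> graph_r t0 K r y z -> z \in G] : set (borel (paths R S))).
  apply: event_and; first exact: event_prop.
  apply: event_forall => y; apply: event_forall => z; apply: event_imp => _.
  have [zG|zG] := boolP (z \in G).
    by apply: (@event_iff _ (borel (paths R S)) (fun=> True)) => //; exact: event_prop.
  apply: (@event_iff _ (borel (paths R S)) (fun K => ~ graph_r t0 K r y z)).
    by move=> K; split=> [H /H|H /H].
  by apply: event_not; apply: event_graph; rewrite mulr_ge0// ltW.
apply: event_and; first exact: m_closed.
apply: event_forall => G.
apply: (@event_iff _ (borel (paths R S)) (fun K => ~ (x \in G /\
    forall y z, y \in G -> graph_r t0 K r y z -> z \in G) \/
    forall y, y \in F -> y \in G)).
  move=> K; split=> [H|[nG /nG//|//]].
  by have [/H|] := pselect (x \in G /\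
    forall y z, y \in G -> graph_r t0 K r y z -> z \in G); [right|left].
by apply: event_or; [apply: event_not; exact: m_closed|exact: event_prop].
Qed.

Lemma event_evolve (r : nat) (Z : paths R S -> config S) (t : R) (x : S) (b : bool) :
  (forall y c, measurable ([set K | Z K y = c] : set (borel (paths R S)))) ->
  r%:R * t0 < t -> t <= r.+1%:R * t0 ->
  measurable ([set K | Gamma_star t0 K /\ evolve t0 K r (Z K) t x = b] :
    set (borel (paths R S))).
Proof.
move=> mZ at_ tb.
apply: (@event_iff _ (borel (paths R S)) (fun K => Gamma_star t0 K /\
  exists F : seq S, component (graph_r t0 K r) x = [set` F] /\
  exists N : nat, forall n, (N <= n)%N ->
    grid_evolution K [set` F] (Z K) (r%:R * t0) ((t - r%:R * t0) / n.+1%:R) n.+1 x = b)).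
  move=> K; split=> -[GK]; have uK := Gamma_star_unit_jumps GK.
    have [F CF] := Gamma_star_component r x GK.
    rewrite (evolveE _ _ CF) => <-; split=> //; exists F; split=> //.
    have [N HN] := evolution_gridP F (Z K) uK t0_gt0 at_ tb.
    by exists N => n /HN ->.
  move=> [F [CF [N HN]]]; split=> //; rewrite (evolveE _ _ CF).
  have [M HM] := evolution_gridP F (Z K) uK t0_gt0 at_ tb.
  by rewrite (HM (maxn M N)) ?leq_maxl// HN// leq_maxr.
apply: event_and; first by apply: measurable_Gamma_star; exact: ltW.
apply: event_exists => F; apply: event_and; first exact: event_component.
apply: event_exists => N; apply: event_forall => n; apply: event_imp => _.
apply: (@event_grid_evolution _ (borel (paths R S)) _ _ id) => //.
- by move=> e s k; exact: measurable_paths_eval.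
- by rewrite mulr_ge0// ltW.
- by rewrite divr_ge0// subr_ge0 ltW.
Qed.

Lemma event_eta_grid sigma (r : nat) (x : S) (b : bool) :
  measurable ([set K | Gamma_star t0 K /\ eta_grid t0 K sigma r x = b] :
    set (borel (paths R S))).
Proof.
have mG : measurable (Gamma_star t0 : set (borel (paths R S))).
  by apply: measurable_Gamma_star; exact: ltW.
elim: r x b => [|r IH] x b.
  by rewrite /=; apply: event_and; [exact: mG|exact: event_prop].
pose Z K := if `[< Gamma_star t0 K >] then eta_grid t0 K sigma r else sigma.
apply: (@event_iff _ (borel (paths R S)) (fun K => Gamma_star t0 K /\
  evolve t0 K r (Z K) (r.+1%:R * t0) x = b)).
  by move=> K; split=> -[GK]; rewrite /= /Z; case: asboolP.
apply: event_evolve => //; last by rewrite ltr_pM2r// ltr_nat.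
move=> y c; apply: (@event_iff _ (borel (paths R S)) (fun K =>
  (Gamma_star t0 K /\ eta_grid t0 K sigma r y = c) \/
  (~ Gamma_star t0 K /\ sigma y = c))).
  move=> K; rewrite /Z; case: asboolP => GK; split; first by left.
  - by case=> -[].
  - by right.
  - by case=> -[].
apply: event_or => //; apply: event_and; last exact: event_prop.
exact: event_not.
Qed.

Lemma cell_left_closed (t : R) : 0 <= t ->
  exists r : nat, r%:R * t0 <= t < r.+1%:R * t0.
Proof.
move=> t_ge0; exists (Num.truncn (t / t0)).
by rewrite -ler_pdivlMr// -ltr_pdivrMr// truncn_itv// divr_ge0// ltW.
Qed.

Lemma cell_right_closed (t : R) : 0 < t ->
  exists r : nat, r%:R * t0 < t <= r.+1%:R * t0.
Proof.
move=> t_gt0; have [r /andP[rt tr]] := cell_left_closed (ltW t_gt0).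
move: rt; rewrite le_eqVlt => /orP[/eqP rt|rt].
  case: r rt tr => [|r] rt tr; first by move: t_gt0; rewrite -rt mul0r ltxx.
  by exists r; rewrite -rt lexx andbT ltr_pM2r// ltr_nat.
by exists r; rewrite rt ltW.
Qed.

Lemma eta_cell K sigma (r : nat) (t : R) : r%:R * t0 < t -> t <= r.+1%:R * t0 ->
  Defs.eta t0 K sigma t = evolve t0 K r (eta_grid t0 K sigma r) t.
Proof.
move=> rt tr; rewrite /Defs.eta leNgt.
have -> : 0 < t by apply: le_lt_trans rt; rewrite mulr_ge0// ltW.
rewrite (@ceil_def _ _ r.+1%:Z)//.
by rewrite -addn1 PoszD addrK -!pmulrn ltr_pdivlMr// ler_pdivrMr// rt addn1.
Qed.

(** At the left end r * t0, [eta] is computed in the previous interval (or is the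
    initial configuration), while no jump time of the new interval has occurred yet:
    both sides are the configuration of the grid.  Having the formula on closed
    intervals gives one-sided limits at the grid times as well. *)
Lemma eta_cell_closed K sigma (r : nat) (t : R) (x : S) (F : seq S) :
  component (graph_r t0 K r) x = [set` F] ->
  r%:R * t0 <= t -> t <= r.+1%:R * t0 ->
  Defs.eta t0 K sigma t x = evolution K t0 r F (eta_grid t0 K sigma r) t x.
Proof.
move=> CF; rewrite le_eqVlt => /orP[/eqP<- _|rt tr]; last first.
  by rewrite (eta_cell _ _ rt tr) (evolveE _ _ CF).
rewrite evolution_start//; case: r CF => [|r] CF.
  by rewrite /Defs.eta mul0r lexx.
by rewrite (@eta_cell _ _ r)// ltr_pM2r// ltr_nat.
Qed.

Lemma event_eta sigma (t : R) (x : S) (b : bool) :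
  measurable ([set K | Gamma_star t0 K /\ Defs.eta t0 K sigma t x = b] :
    set (borel (paths R S))).
Proof.
have mG : measurable (Gamma_star t0 : set (borel (paths R S))).
  by apply: measurable_Gamma_star; exact: ltW.
have [t_le0|t_gt0] := leP t 0.
  rewrite /Defs.eta t_le0; by apply: event_and; [exact: mG|exact: event_prop].
have [r /andP[rt tr]] := cell_right_closed t_gt0.
pose Z K := if `[< Gamma_star t0 K >] then eta_grid t0 K sigma r else sigma.
apply: (@event_iff _ (borel (paths R S)) (fun K => Gamma_star t0 K /\
  evolve t0 K r (Z K) t x = b)).
  by move=> K; rewrite (eta_cell _ _ rt tr); split=> -[GK]; rewrite /= /Z; case: asboolP.
apply: event_evolve => // y c.
apply: (@event_iff _ (borel (paths R S)) (fun K =>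
  (Gamma_star t0 K /\ eta_grid t0 K sigma r y = c) \/
  (~ Gamma_star t0 K /\ sigma y = c))).
  move=> K; rewrite /Z; case: asboolP => GK; split; first by left.
  - by case=> -[].
  - by right.
  - by case=> -[].
apply: event_or; first exact: event_eta_grid.
by apply: event_and; [apply: event_not; exact: mG|exact: event_prop].
Qed.

Lemma eta_right_continuous K sigma (t : R) : Gamma_star t0 K -> 0 <= t ->
  Defs.eta t0 K sigma @ t^'+ --> Defs.eta t0 K sigma t.
Proof.
move=> GK t_ge0; apply: cvg_config => x.
have [r /andP[rt tr]] := cell_left_closed t_ge0.
have [F CF] := Gamma_star_component r x GK.
have [d d0 H] := (step_edge_counts K F).1 t t_ge0.
near=> s.
have ts : t < s by near: s; exact: nbhs_right_gt.
have sr : s < r.+1%:R * t0 by near: s; exact: nbhs_right_lt.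
have sd : s < t + d by near: s; apply: nbhs_right_lt; rewrite ltrDl.
rewrite (eta_cell_closed _ CF rt (ltW tr)).
rewrite (eta_cell_closed _ CF (le_trans rt (ltW ts)) (ltW sr)).
rewrite (evolution_const _ rt (ltW ts) (ltW sr))//.
move=> u [/andP[tu us] [e [sF dF]]]; apply: no_up_jump tu _ sF dF => u' tu'.
by rewrite !H//; lra.
Unshelve. all: by end_near. Qed.

Lemma eta_left_limit K sigma (t : R) : Gamma_star t0 K -> 0 < t ->
  exists l : config S, Defs.eta t0 K sigma @ t^'- --> l.
Proof.
move=> GK t_gt0; have [r /andP[rt tr]] := cell_right_closed t_gt0.
have loc x : exists b, \forall s \near t^'-, Defs.eta t0 K sigma s x = b.
  have [F CF] := Gamma_star_component r x GK.
  have [d d0 [v H]] := (step_edge_counts K F).2 t t_gt0.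
  pose p := Num.max (r%:R * t0) (t - d / 2).
  have pt : p < t by rewrite gt_max rt/=; lra.
  have rp : r%:R * t0 <= p by rewrite le_max lexx.
  have dp : t - d / 2 <= p by rewrite le_max lexx orbT.
  move: p pt rp dp => p pt rp dp.
  exists (evolution K t0 r F (eta_grid t0 K sigma r) p x).
  near=> s.
  have ps : p < s by near: s; exact: nbhs_left_gt.
  have st : s < t by near: s; exact: nbhs_left_lt.
  rewrite (eta_cell_closed _ CF); [|lra|lra].
  have sr : s <= r.+1%:R * t0 by lra.
  rewrite (evolution_const _ rp (ltW ps) sr)//.
  move=> u [/andP[pu us] [e [sF dF]]]; apply: no_up_jump pu _ sF dF => u' pu'.
  by rewrite !H//; lra.
exists (fun x => projT1 (cid (loc x))); apply: cvg_config => x.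
exact: (projT2 (cid (loc x))).
Unshelve. all: by end_near. Qed.

Lemma eta_neg K sigma (t : R) : t < 0 -> Defs.eta t0 K sigma t = Defs.eta t0 K sigma 0.
Proof. by move=> t_lt0; rewrite /Defs.eta lexx ltW. Qed.

Lemma evolution_local K (r : nat) (F : seq S) (z z' : config S) (t : R) :
  (forall x, x \in F -> z x = z' x) ->
  forall x, x \in F -> evolution K t0 r F z t x = evolution K t0 r F z' t x.
Proof.
rewrite /evolution; elim: (sort _ _) z z' => [//|s l IH] z z' zz' /=.
by apply: IH; exact: (@fire_local _ [set` F]).
Qed.

Lemma component_self (r : nat) K (x : S) (F : seq S) :
  component (graph_r t0 K r) x = [set` F] -> x \in F.
Proof.
move=> CF; suff : component (graph_r t0 K r) x x by rewrite CF.
exact: rt_refl.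
Qed.

(** The sites that matter at time (r + 1) * t0 are found in the finite component of
    x; each of them depends on finitely many sites at time 0 by induction. *)
Lemma eta_grid_local K (r : nat) (x : S) : Gamma_star t0 K ->
  exists D : seq S, forall sigma sigma', (forall y, y \in D -> sigma y = sigma' y) ->
    eta_grid t0 K sigma r x = eta_grid t0 K sigma' r x.
Proof.
move=> GK; elim: r x => [|r IH] x.
  by exists [:: x] => sigma sigma' /(_ x); rewrite inE eqxx; exact.
have [F CF] := Gamma_star_component r x GK.
exists (flatten [seq projT1 (cid (IH y)) | y <- F]) => sigma sigma' ss'.
rewrite /= !(evolveE _ _ CF); apply: evolution_local (component_self CF) => y yF.
apply: (projT2 (cid (IH y))) => u uD; apply: ss'.
by apply/flattenP; exists (projT1 (cid (IH y))) => //; exact: map_f.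
Qed.

Lemma eta_local K (t : R) (x : S) : Gamma_star t0 K ->
  exists D : seq S, forall sigma sigma', (forall y, y \in D -> sigma y = sigma' y) ->
    Defs.eta t0 K sigma t x = Defs.eta t0 K sigma' t x.
Proof.
move=> GK; have [t_le0|t_gt0] := leP t 0.
  exists [:: x] => sigma sigma' /(_ x); rewrite /Defs.eta t_le0 inE eqxx; exact.
have [r /andP[rt tr]] := cell_right_closed t_gt0.
have [F CF] := Gamma_star_component r x GK.
exists (flatten [seq projT1 (cid (eta_grid_local r y GK)) | y <- F]) => sigma sigma' ss'.
rewrite !(eta_cell _ _ rt tr) !(evolveE _ _ CF).
apply: evolution_local (component_self CF) => y yF.
apply: (projT2 (cid (eta_grid_local r y GK))) => u uD; apply: ss'.
by apply/flattenP; exists (projT1 (cid (eta_grid_local r y GK))) => //; exact: map_f.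
Qed.

Lemma nbhs_config_agree sigma (D : seq S) :
  \forall sigma' \near sigma, forall y, y \in D -> sigma' y = sigma y.
Proof.
elim: D => [|y D IH]; first by apply: filterE.
apply: filterS2 (nbhs_config_coord sigma y) IH => sigma' sy sD u.
by rewrite inE => /orP[/eqP->//|]; exact: sD.
Qed.

Lemma continuous_eta K (t : R) : Gamma_star t0 K ->
  continuous (fun sigma : config S => Defs.eta t0 K sigma t).
Proof.
move=> GK sigma; apply: cvg_config => x.
have [D HD] := eta_local t x GK.
by apply: filterS (nbhs_config_agree sigma D) => sigma' ss'; exact: HD.
Qed.

End Eta.

(** * The semigroup and the Feller property *)

Section Semigroup.
Context (R : realType) (S : countType) (t0 : R) (t0_gt0 : 0 < t0).
Context (P : probability (borel (paths R S)) R).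

Let mG : measurable (Gamma_star t0 : set (borel (paths R S))) :=
  measurable_Gamma_star (ltW t0_gt0).

Lemma cadlag_ext (W : uniformType) (w v : cadlag R W) : w = v :> (R -> W) -> w = v.
Proof.
case: w v => [w w1 w2 w3] [v v1 v2 v3] /= wv; move: w1 w2 w3 v1 v2 v3; rewrite wv.
by move=> *; congr Cadlag; exact: Prop_irrelevance.
Qed.

(** Outside of Gamma_star the path is constant; this makes the map total without
    changing the restriction of P to Gamma_star. *)
Definition sep_path (sigma : config S) (K : borel (paths R S)) :
    borel (cadlag R (config S)) :=
  match pselect (Gamma_star t0 K) with
  | left GK => @Cadlag R (config S) (Defs.eta t0 K sigma)
      (fun t h => eta_right_continuous t0_gt0 GK h)
      (fun t h => eta_left_limit t0_gt0 sigma GK h)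
      (fun t h => @eta_neg R S t0 K sigma t h)
  | right _ => cst_path R sigma
  end.

Lemma sep_pathE (sigma : config S) (K : paths R S) : Gamma_star t0 K ->
  (sep_path sigma K : cadlag R (config S)) = Defs.eta t0 K sigma :> (R -> config S).
Proof. by move=> GK; rewrite /sep_path; case: pselect. Qed.

Lemma event_sep_path (sigma : config S) (t : R) (x : S) (b : bool) :
  measurable [set K | (sep_path sigma K : cadlag R (config S)) t x = b].
Proof.
apply: (@event_iff _ (borel (paths R S)) (fun K =>
  (Gamma_star t0 K /\ Defs.eta t0 K sigma t x = b) \/
  (~ Gamma_star t0 K /\ sigma x = b))).
  move=> K; rewrite /sep_path; case: pselect => GK /=; split.
  - by left.
  - by case=> -[].
  - by right.
  - by case=> -[].
apply: event_or; first exact: event_eta.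
by apply: event_and; [apply: event_not; exact: mG|exact: event_prop].
Qed.

Lemma measurable_sep_path (sigma : config S) :
  measurable_fun [set: borel (paths R S)] (sep_path sigma).
Proof. by apply: measurable_fun_skorohod => t x b _; exact: event_sep_path. Qed.

Lemma SEP_lawE (sigma : config S) :
  SEP_law P t0 sigma = pushforward (mrestr P mG) (sep_path sigma).
Proof.
apply/funext => A; rewrite /SEP_law /pushforward /mrestr; congr (P _).
apply/seteqP; split=> K /=.
  move=> [GK [w Aw ew]]; split=> //=.
  by rewrite (_ : sep_path sigma K = w)//; apply: cadlag_ext; rewrite sep_pathE.
move=> [AK GK]; split=> //; exists (sep_path sigma K) => //.
by rewrite sep_pathE.
Qed.

Lemma config_compact : compact [set: config S].
Proof.
have := @tychonoff S (fun _ => bool) (fun _ => setT) (fun _ => bool_compact).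
by congr compact; apply/seteqP; split.
Qed.

Lemma continuous_config_bounded (f : config S -> R) : continuous f ->
  exists M : R, forall z, `|f z| <= M.
Proof.
move=> cf; have /compact_bounded[M [_ HM]] :=
  continuous_compact (continuous_subspaceT cf) config_compact.
by exists (M + 1) => z; apply: (HM (M + 1)); [rewrite ltrDl|exists z].
Qed.

Lemma measurable_comp_config d (T : measurableType d) (f : config S -> R)
    (X : T -> config S) :
  continuous f -> (forall x b, measurable [set w | X w x = b]) ->
  measurable_fun [set: T] (fun w => f (X w)).
Proof.
move=> cf mX; apply: (measurability _ (RGenOpens.measurableE R)) => //.
move=> _ [_ [a [b ->]] <-]; rewrite setTI.
apply: (@measurable_open_config _ _ _ X (f @^-1` `]a, b[%classic)) => //.
by apply: open_comp => // z _; exact: cf.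
Qed.

Section Observable.
Context (f : config S -> R) (cf : continuous f) (t : R) (t_ge0 : 0 <= t).

Lemma measurable_eval_path :
  measurable_fun [set: borel (cadlag R (config S))]
    (fun w => f ((w : cadlag R (config S)) t)).
Proof.
by apply: measurable_comp_config => // x b; exact: measurable_config_path_eval.
Qed.

Lemma measurable_eval_sep (sigma : config S) :
  measurable_fun [set: borel (paths R S)]
    (fun K => f ((sep_path sigma K : cadlag R (config S)) t)).
Proof. by apply: measurable_comp_config => // x b; exact: event_sep_path. Qed.

Lemma integrable_bounded (mu : {measure set (borel (paths R S)) -> \bar R})
    (D : set (borel (paths R S))) (g : borel (paths R S) -> config S) :
  measurable D -> (mu D < +oo)%E -> measurable_fun D (fun K => f (g K)) ->
  mu.-integrable D (fun K => (f (g K))%:E).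
Proof.
move=> mD muD mg; apply: measurable_bounded_integrable => //.
have [M HM] := continuous_config_bounded cf.
exists M; split; first exact: num_real.
by move=> x Mx K _ /=; rewrite (le_trans (HM _))// ltW.
Qed.

Let P_fin (A : set (borel (paths R S))) : measurable A -> (P A < +oo)%E.
Proof. by move=> mA; rewrite (le_lt_trans (probability_le1 P mA))// ltry. Qed.

Lemma integrable_eval_sep (sigma : config S) :
  P.-integrable (Gamma_star t0)
    (fun K => (f ((sep_path sigma K : cadlag R (config S)) t))%:E).
Proof.
apply: (@integrable_bounded P _
  (fun K => (sep_path sigma K : cadlag R (config S)) t)) => //.
  exact: P_fin.
exact: measurable_funS (measurable_eval_sep sigma).
Qed.

Lemma SEP_semigroupE (sigma : config S) :
  (SEP_semigroup P t0 t f sigma)%:E =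
  (\int[P]_(K in Gamma_star t0)
     (f ((sep_path sigma K : cadlag R (config S)) t))%:E)%E.
Proof.
rewrite /SEP_semigroup /Rintegral.
rewrite (_ : (\int[P]_(K in _) _)%E = (\int[P]_(K in Gamma_star t0)
     (f ((sep_path sigma K : cadlag R (config S)) t))%:E)%E).
  by rewrite fineK//; apply: integrable_fin_num => //; exact: integrable_eval_sep.
by apply: eq_integral => K /set_mem GK; rewrite sep_pathE.
Qed.

Lemma integral_SEP_law (sigma : config S) :
  (\int[SEP_law P t0 sigma]_w (f ((w : cadlag R (config S)) t))%:E =
   \int[P]_(K in Gamma_star t0)
     (f ((sep_path sigma K : cadlag R (config S)) t))%:E)%E.
Proof.
pose g := fun K : borel (paths R S) => (f ((sep_path sigma K : cadlag R (config S)) t))%:E.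
have intg : (mrestr P mG).-integrable [set: borel (paths R S)] g.
  apply: (@integrable_bounded (mrestr P mG) _
      (fun K => (sep_path sigma K : cadlag R (config S)) t)) => //.
    exact: (P_fin (measurableI _ _ measurableT mG)).
  exact: measurable_eval_sep.
pose ft (w : borel (cadlag R (config S))) := (f ((w : cadlag R (config S)) t))%:E.
have mf : measurable_fun [set: borel (cadlag R (config S))] ft.
  by apply/measurable_EFinP; exact: measurable_eval_path.
rewrite SEP_lawE.
rewrite (integral_pushforward (measurable_sep_path sigma) mf intg measurableT).
rewrite preimage_setT (@negligible_integral _ _ _ (mrestr P mG) setT (~` Gamma_star t0))//.
- rewrite setDE setTI setCK; apply: eq_measure_integral => A mA AG.
  by change (P (A `&` Gamma_star t0) = P A); rewrite setIidl.
- exact: measurableC.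
- by change (P (~` Gamma_star t0 `&` Gamma_star t0) = 0%E); rewrite setICl measure0.
Qed.

(** Dominated convergence: the integrands converge pointwise on Gamma_star and are
    bounded by a constant. *)
Lemma SEP_semigroup_cvg_seq (sigma : config S) (s : nat -> config S) :
  s @ \oo --> sigma ->
  SEP_semigroup P t0 t f (s n) @[n --> \oo] --> SEP_semigroup P t0 t f sigma.
Proof.
move=> s_sigma; have [M HM] := continuous_config_bounded cf.
pose h z (K : borel (paths R S)) := (f ((sep_path z K : cadlag R (config S)) t))%:E.
have mh z : measurable_fun (Gamma_star t0) (h z).
  by apply/measurable_EFinP; apply: measurable_funS (measurable_eval_sep z).
have [_ _ int_cvg] : [/\ P.-integrable (Gamma_star t0) (h sigma),
    [sequence \int[P]_(K in Gamma_star t0) `|h (s n) K - h sigma K| ]_n @ \oo --> 0 &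
    [sequence \int[P]_(K in Gamma_star t0) h (s n) K]_n @ \oo -->
      \int[P]_(K in Gamma_star t0) h sigma K]%E.
  apply: (@dominated_convergence _ _ _ P _ mG (fun n => h (s n)) (h sigma)
    (fun=> M%:E)) => //.
  - apply: aeW => K GK; rewrite /h.
    have -> : (fun n => (f ((sep_path (s n) K : cadlag R (config S)) t))%:E) =
        (fun n => (f (Defs.eta t0 K (s n) t))%:E).
      by apply/funext => n; rewrite sep_pathE.
    rewrite sep_pathE//; apply/cvg_EFin; first by apply: nearW.
    apply: (@cvg_comp _ _ _ s (fun z => f (Defs.eta t0 K z t)) _ _ _ s_sigma).
    apply: (@cvg_comp _ _ _ (fun z => Defs.eta t0 K z t) f); last exact: cf.
    exact: continuous_eta.
  - by apply: finite_measure_integrable_cst.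
  - by apply: aeW => K n _; rewrite lee_fin.
rewrite (_ : (fun n => _) = (fun n => fine (\int[P]_(K in Gamma_star t0) h (s n) K)%E)).
  rewrite (_ : SEP_semigroup _ _ _ _ _ = fine (\int[P]_(K in Gamma_star t0) h sigma K)%E).
    by apply: fine_cvg; rewrite fineK//; rewrite -SEP_semigroupE.
  by rewrite -SEP_semigroupE.
by apply/funext => n; rewrite -SEP_semigroupE.
Qed.

Lemma SEP_semigroup_continuous : continuous (SEP_semigroup P t0 t f).
Proof.
move=> sigma; apply/cvgrPdist_lt => e e0; apply: contrapT => not_near.
(* otherwise a sequence converging to sigma along the first n sites stays away *)
pose D (n : nat) : seq S := pmap (@choice.unpickle S) (iota 0 n).
have far n : exists sigma' : config S, (forall x, x \in D n -> sigma' x = sigma x) /\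
    e <= `|SEP_semigroup P t0 t f sigma - SEP_semigroup P t0 t f sigma'|.
  apply: contrapT => none; apply: not_near.
  apply: filterS (nbhs_config_agree sigma (D n)) => sigma' agree.
  by rewrite ltNge; apply/negP => far; apply: none; exists sigma'.
have [s Hs] := choice far.
have s_sigma : s @ \oo --> sigma.
  apply: cvg_config => x; exists (choice.pickle x).+1 => // n /= xn.
  apply: (Hs n).1; rewrite mem_pmap; apply/mapP; exists (choice.pickle x).
    by rewrite mem_iota.
  by rewrite choice.pickleK.
have /cvgrPdist_lt/(_ e e0)[N _ HN] := SEP_semigroup_cvg_seq s_sigma.
by have := HN N (leqnn N); rewrite /= ltNge (Hs N).2.
Qed.

End Observable.
End Semigroup.

Theorem proposition5p10 (R : realType) (S : countType)
    (infS : infinite_set [set: S])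
    (c : edge S -> R) (c_ge0 : forall e, 0 <= c e)
    (P : probability (borel (paths R S)) R) (P_poisson : poisson_law c P)
    (t0 : R) (t0_gt0 : 0 < t0) (P_SEP : assumption_SEP P t0) :
  (forall (f : config S -> R) (t : R), continuous f -> 0 <= t ->
     (forall sigma : config S,
        (SEP_semigroup P t0 t f sigma)%:E =
        (\int[SEP_law P t0 sigma]_w (f ((w : cadlag R (config S)) t))%:E)%E) /\
     continuous (SEP_semigroup P t0 t f)) /\
  Feller (SEP_law P t0).
Proof.
have change_of_variables (f : config S -> R) (t : R) (sigma : config S) :
    continuous f -> 0 <= t -> (SEP_semigroup P t0 t f sigma)%:E =
    (\int[SEP_law P t0 sigma]_w (f ((w : cadlag R (config S)) t))%:E)%E.
  by move=> cf t_ge0; rewrite integral_SEP_law// -SEP_semigroupE.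
split=> [f t cf t_ge0|f t cf t_ge0].
  split=> [sigma|]; first exact: change_of_variables.
  exact: SEP_semigroup_continuous.
rewrite (_ : (fun sigma => _) = SEP_semigroup P t0 t f).
  exact: SEP_semigroup_continuous.
by apply/funext => sigma; rewrite -change_of_variables.
Qed.
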